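(* Let $n\geq 1$, let $\alpha_i>0$ and $\beta_i>0$ for $i=1,\ldots,n$, let $\beta>0$, and let $\alpha_+=\sum_{i=1}^n\alpha_i$. Let $S=\sum_{i=1}^n\beta_iS_i$, where $S_1,\ldots,S_n$ are independent with $S_i\sim\mathrm{Gam}(\alpha_i,1)$, and let $T\sim\mathrm{Gam}(\alpha_+,\beta)$. Then: 1. $T\leq_{st}S$ if and only if $\beta\leq\left(\prod_{i=1}^n\beta_i^{\alpha_i}\right)^{1/\alpha_+}$; likewise, $T\leq_{hr}S$ if and only if $\beta\leq\left(\prod_{i=1}^n\beta_i^{\alpha_i}\right)^{1/\alpha_+}$. 2. $T\leq_{lr}S$ if and only if $\beta\leq \alpha_+\big/\left(\sum_{i=1}^n\alpha_i/\beta_i\right)$; likewise, $T\leq_{rh}S$ if and only if $\beta\leq \alpha_+\big/\left(\sum_{i=1}^n\alpha_i/\beta_i\right)$.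
   Context: $\mathrm{Gam}(\alpha,\beta)$ ($\alpha,\beta>0$) is the gamma distribution with shape $\alpha$ and scale $\beta$, i.e. with density $\Gamma(\alpha)^{-1}\beta^{-\alpha}x^{\alpha-1}\exp(-x/\beta)$, $x>0$. Let $X,Y$ have pdfs $f,g$ supported on $(0,\infty)$ (for $S$ and $T$ take the versions continuous on $(0,\infty)$) and cumulative distribution functions $F,G$, and put $\bar F=1-F$, $\bar G=1-G$. Usual stochastic order: $X\leq_{st}Y$ if $\bar F(x)\leq\bar G(x)$ for all $x$. Hazard rate order: $X\leq_{hr}Y$ if $f(x)/\bar F(x)\geq g(x)/\bar G(x)$ for all $x>0$. Reversed hazard rate order: $X\leq_{rh}Y$ if $f(x)/F(x)\leq g(x)/G(x)$ for all $x>0$. Likelihood ratio order: $X\leq_{lr}Y$ if $f(x)/g(x)$ is a monotone decreasing (i.e. non-increasing) function on $(0,\infty)$. *)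

(* Defs.v *)
From HB Require Import structures.
From mathcomp Require Export all_boot all_order all_algebra.
From mathcomp Require Export all_classical all_reals all_analysis.
Export Order.TTheory GRing.Theory Num.Theory.
Export numFieldNormedType.Exports.

Set Implicit Arguments.
Unset Strict Implicit.
Unset Printing Implicit Defensive.

Local Open Scope classical_set_scope.
Local Open Scope ring_scope.

Section gamma.
Context {R : realType}.

Definition gamma_fun (a : R) : R :=
  \int[lebesgue_measure]_(x in `]0, +oo[) (x `^ (a - 1) * expR (- x)).

(* shape a, scale b *)
Definition gamma_pdf (a b x : R) : R :=
  if 0 < x
  then (gamma_fun a)^-1 * b `^ (- a) * x `^ (a - 1) * expR (- (x / b))
  else 0.

End gamma.

Section random_variables.
Context {R : realType} {d : measure_display} {Omega : measurableType d}
  {P : probability Omega R}.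

Definition has_density (X : {RV P >-> R}) (f : R -> R) : Prop :=
  forall A : set R, measurable A ->
    distribution P X A = (\int[lebesgue_measure]_(x in A) (f x)%:E)%E.

Definition gamma_distributed (a b : R) (X : {RV P >-> R}) : Prop :=
  has_density X (gamma_pdf a b).

(* The version of the density of X that is positive and continuous on
   (0, +oo) and vanishes elsewhere: if it exists, it is unique. *)
Definition is_pdf (X : {RV P >-> R}) (f : R -> R) : Prop :=
  [/\ measurable_fun [set: R] f,
      forall x : R, x <= 0 -> f x = 0,
      forall x : R, 0 < x -> 0 < f x,
      {in `]0, +oo[, continuous f}
    & has_density X f].

Definition independent_RVs (I : finType) (X : I -> {RV P >-> R}) : Prop :=
  forall (J : {set I}) (A : I -> set R),
    (forall i, i \in J -> measurable (A i)) ->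
    P (\bigcap_(i in [set` J]) (X i @^-1` A i)) =
    (\prod_(i in J) P (X i @^-1` A i))%E.

End random_variables.

(* The variables that are compared may live on different probability spaces.
   As pdfs in the sense of is_pdf are unique, "exists f g" below amounts to
   "X and Y have pdfs, and these pdfs f and g satisfy ..." *)
Section stochastic_orders.
Context {R : realType}.
Context {d : measure_display} {Omega : measurableType d}
  {P : probability Omega R}.
Context {d' : measure_display} {Omega' : measurableType d'}
  {P' : probability Omega' R}.
Implicit Types (X : {RV P >-> R}) (Y : {RV P' >-> R}).

Definition st_le X Y : Prop := forall x : R, (ccdf X x <= ccdf Y x)%E.

Definition hr_le X Y : Prop :=
  exists f g : R -> R, [/\ is_pdf X f, is_pdf Y g &
    forall x : R, 0 < x -> f x / fine (ccdf X x) >= g x / fine (ccdf Y x)].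

Definition rh_le X Y : Prop :=
  exists f g : R -> R, [/\ is_pdf X f, is_pdf Y g &
    forall x : R, 0 < x -> f x / fine (cdf X x) <= g x / fine (cdf Y x)].

Definition lr_le X Y : Prop :=
  exists f g : R -> R, [/\ is_pdf X f, is_pdf Y g &
    forall x y : R, 0 < x -> x <= y -> f y / g y <= f x / g x].

End stochastic_orders.

(* Main.v *)
From HB Require Import structures.
Require Import Defs.
From mathcomp Require Import measurable_realfun ring lra.

Local Open Scope classical_set_scope.
Local Open Scope ring_scope.

(** Let f_T, f_S be the densities of T and S, and a the sum of the alpha_i.
   All four orders are properties of the ratio h = f_S / f_T on (0, +oo), and
   the proof consists in showing that h is convex, with known value and slope
   at 0.

   Shape of h. Writing the vector of the beta_i S_i as its total times a point
   of the simplex gives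
     f_S(x) = C x^(a - 1) phi(x),   phi(x) = E exp(- x sum_i D_i / beta_i),
   where D follows the Dirichlet law of parameters alpha_i, and where
   C^-1 = Gamma(a) prod_i beta_i^alpha_i. The proof reaches this form one summand
   at a time: when an independent gamma variable is added to a sum, the
   substitution y = x t in the convolution integral replaces phi by
     x |-> E (phi(x (1 - t)) exp(- x t / beta_i)),   t of a beta law
   [convol_gamma_laplace_like], and what is used of phi is stable under this
   operation [laplace_like, mixture_laplace_like]: exp(lam x) phi(x) is convex
   for every lam, phi is nonincreasing, phi(x) >= exp(- m x) and
   phi(x) <= 1 - m x + O(x^2), where m = (sum_i alpha_i / beta_i) / a is the mean
   of sum_i D_i / beta_i. An induction on the number of summands then yields the
   density of S [weighted_sum_density]. Consequently
     h(x) = c exp(x / beta) phi(x),   c = beta^a / prod_i beta_i^alpha_i,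
   is convex, h(0) = c and h'(0) = c (1 / beta - m). The condition of part 1
   says that c <= 1, and that of part 2 that h'(0) >= 0.

   Part 1. The order T <=_hr S means h(x) P(T > x) <= P(S > x) for all x > 0.
   Since h is convex with h(0) <= 1, at a given x either h >= h(x) on [x, +oo),
   and integrating f_S = h f_T over (x, +oo) proves the inequality, or h(x) <= 1
   and h <= 1 on (0, x], so that P(S <= x) <= P(T <= x) and
   P(S > x) >= P(T > x) >= h(x) P(T > x) [hr_le_of_convex]. The usual order is
   obtained in the same way [st_le_of_convex]. Conversely c <= 1 appears when x
   tends to 0 from the right.

   Part 2. The order T <=_lr S means that h is nondecreasing, which by convexity
   amounts to h'(0) >= 0. Then P(S <= x) <= h(x) P(T <= x), which is the meaning
   of T <=_rh S. If on the contrary h'(0) < 0, then h > h(x) on (0, x) for some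
   x, the last inequality is reversed and strict, and both orders fail
   [tilt_decreasing_near0, ratio_lt_cdf]. *)

(** * Integrals on the line *)

Section integrals.
Context {R : realType}.
Local Notation mu := (@lebesgue_measure R).
Implicit Types (f g : R -> R) (A D : set R).

Lemma lebesgue_measure_preimage_affine (c d : R) A : 0 < c -> measurable A ->
  (mu ((fun x => (c * x + d)%R) @^-1` A) = (c^-1)%:E * mu A)%E.
Proof.
move=> c0 mA; have c0' : (0 <= c)%R by exact: ltW.
pose aff (x : measurableTypeR R) : measurableTypeR R := c * x + d.
have maff : measurable_fun setT aff.
  by apply: measurable_funD => //; exact: measurable_funM.
have -> : mu A = pushforward (mscale (NngNum c0') mu) aff A.
  apply: lebesgue_measure_unique => // _ [[a b]] _ <-.
  rewrite /pushforward /mscale/=.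
  rewrite [X in (_ = _ * lebesgue_measure X)%E]
    (_ : _ = `](a - d) / c, (b - d) / c]%classic); last first.
    apply/seteqP; split => x /=; rewrite !in_itv/= ltr_pdivrMr// ler_pdivlMr// /aff; lra.
  rewrite !lebesgue_measure_itv/= !lte_fin ltr_pM2r ?invr_gt0// ltrD2r.
  case: ifPn => _; last by rewrite mule0.
  rewrite -!EFinD -EFinM; congr EFin; field; lra.
by rewrite /pushforward /mscale/= muleA -EFinM mulVf ?gt_eqF// mul1e.
Qed.

Lemma ge0_integral_affine (c d : R) (F : R -> \bar R) : 0 < c ->
  measurable_fun setT F -> (forall x, 0 <= F x)%E ->
  (\int[mu]_x F (c * x + d)%R = (c^-1)%:E * \int[mu]_x F x)%E.
Proof.
move=> c0 mF F0.
pose aff (x : measurableTypeR R) : measurableTypeR R := (c * x + d)%R.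
have maff : measurable_fun setT aff.
  by apply: measurable_funD => //; exact: measurable_funM.
have c0' : (0 <= c^-1)%R by rewrite invr_ge0 ltW.
rewrite -[X in (X * _)%E]/((NngNum c0')%:num%:E) -ge0_integral_mscale//.
rewrite -[LHS](@ge0_integral_pushforward _ _ _ (measurableTypeR R) R _ maff mu setT F)//.
apply: eq_measure_integral => A mA _.
exact: lebesgue_measure_preimage_affine.
Qed.

Lemma integral_gt0 D f : measurable D -> (0 < mu D)%E -> measurable_fun D f ->
  (forall x, D x -> 0 < f x) -> (0 < \int[mu]_(x in D) (f x)%:E)%E.
Proof.
move=> mD D0 mf f0.
rewrite lt_neqAle integral_ge0 ?andbT; last by move=> x Dx; rewrite lee_fin ltW// f0.
apply/eqP => I0.
have : ae_eq mu D (EFin \o f) (cst 0%E).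
  apply/ae_eq_integral_abs => //; first exact/measurable_EFinP.
  rewrite [RHS]I0; apply: eq_integral => x /[!inE] Dx.
  by rewrite gee0_abs// lee_fin ltW// f0.
case=> N [mN N0 sub].
have : (mu D <= mu N)%E.
  apply: le_measure; rewrite ?inE// => x Dx; apply: sub => /= /(_ Dx) /= [] fx.
  by move: (f0 _ Dx); rewrite fx ltxx.
by rewrite N0 leNgt D0.
Qed.

Lemma lebesgue_measure_itv_gt0 (a b : R) (x y : bool) : a < b ->
  (0 < mu [set` Interval (BSide x a) (BSide y b)])%E.
Proof. by move=> ab; rewrite lebesgue_measure_itv/= lte_fin ab -EFinD lte_fin subr_gt0. Qed.

(** If f x < g x, continuity propagates the strict inequality to a ball around
   x, on which the two integrals would then differ. *)
Lemma continuous_density_le f g x : measurable_fun setT f -> measurable_fun setT g ->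
  (forall y, 0 <= f y) -> {for x, continuous f} -> {for x, continuous g} ->
  (\int[mu]_y (f y)%:E < +oo)%E ->
  (forall A, measurable A -> \int[mu]_(y in A) (f y)%:E = \int[mu]_(y in A) (g y)%:E)%E ->
  g x <= f x.
Proof.
move=> mf mg f0 cf cg fi fg; rewrite leNgt; apply/negP => fgx.
have : \forall y \near x, 0 < g y - f y.
  have cgf : (fun y => g y - f y) y @[y --> x] --> g x - f x by exact: (cvgB cg cf).
  by apply: (cvgr_gt _ cgf); rewrite subr_gt0.
move=> /nbhs_ballP[e /= e0 sub].
pose I := ball x e; have mI : measurable I by exact: measurable_ball.
have I0 : (0 < mu I)%E by rewrite /I ball_itv lebesgue_measure_itv_gt0//; move: e0; rewrite /=; lra.
have mS (h : R -> R) : measurable_fun setT h -> measurable_fun I h by exact: measurable_funTS.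
have mEf : measurable_fun I (EFin \o f) by apply/measurable_EFinP; exact: mS.
have d0 : (0 < \int[mu]_(y in I) (g y - f y)%:E)%E.
  by apply: integral_gt0 => //; apply: measurable_funB; exact: mS.
have fiI : (\int[mu]_(y in I) (f y)%:E < +oo)%E.
  apply: le_lt_trans fi; apply: ge0_subset_integral => //; first exact/measurable_EFinP.
  by move=> y _; rewrite lee_fin.
have : (\int[mu]_(y in I) (g y)%:E =
   \int[mu]_(y in I) (f y)%:E + \int[mu]_(y in I) (g y - f y)%:E)%E.
  rewrite -ge0_integralD//.
  - by apply: eq_integral => y _; rewrite -EFinD addrC subrK.
  - by move=> y _; rewrite lee_fin.
  - by move=> y Iy; rewrite lee_fin ltW// sub.
  - by apply/measurable_EFinP; apply: measurable_funB; exact: mS.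
rewrite -fg// => E.
have fin : (\int[mu]_(y in I) (f y)%:E \is a fin_num)%E.
  by rewrite ge0_fin_numE// integral_ge0// => y _; rewrite lee_fin.
by move: d0; rewrite -(lteDl _ fin) -[ltRHS]E ltxx.
Qed.

Definition convol f g s : \bar R := (\int[mu]_y (g y * f (s - y))%:E)%E.

(** The convolution is the density of a sum: this is translation invariance in
   the inner integral, followed by Tonelli. *)
Lemma integral_convol f g A : measurable_fun setT f -> measurable_fun setT g ->
  (forall x, 0 <= f x) -> (forall x, 0 <= g x) -> measurable A ->
  (\int[mu]_(s in A) convol f g s =
   \int[mu]_y ((g y)%:E * \int[mu]_x ((f x)%:E * (\1_A (x + y))%:E)))%E.
Proof.
move=> mf mg f0 g0 mA.
have m1 : measurable_fun [set: R] (\1_A : R -> R) by exact/measurable_indicP.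
transitivity (\int[mu]_s \int[mu]_y (g y * (f (s - y) * \1_A s))%:E)%E.
  rewrite integral_mkcond; apply: eq_integral => s _.
  rewrite patchE; case: ifPn => sA.
    by apply: eq_integral => y _; rewrite indicE sA mulr1.
  by rewrite integral0_eq// => y _; rewrite indicE (negbTE sA) !mulr0.
pose F (p : R * R) : \bar R := (g p.2 * (f (p.1 - p.2) * \1_A p.1))%:E.
rewrite -[LHS]/(\int[mu]_s fubini_F mu F s)%E fubini_tonelli; last 2 first.
  apply/measurable_EFinP; apply: measurable_funM; first exact: measurableT_comp.
  apply: measurable_funM; last exact: measurableT_comp.
  by apply: measurableT_comp => //; exact: measurable_funB.
  by move=> p; rewrite lee_fin !mulr_ge0.
apply: eq_integral => y _; rewrite /fubini_G /F/=.
under eq_integral do rewrite EFinM.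
rewrite ge0_integralZl//; last 3 first.
- apply/measurable_EFinP; apply: measurable_funM => //.
  by apply: measurableT_comp => //; exact: measurable_funB.
- by move=> x _; rewrite lee_fin mulr_ge0.
- by rewrite lee_fin.
congr (_ * _)%E.
have := @ge0_integral_affine 1 y (fun s => (f (s - y) * \1_A s)%:E) ltr01.
rewrite invr1 mul1e => <-; last 2 first.
- apply/measurable_EFinP; apply: measurable_funM => //.
  by apply: measurableT_comp => //; exact: measurable_funB.
- by move=> x; rewrite lee_fin mulr_ge0.
by apply: eq_integral => x _; rewrite mul1r addrK EFinM.
Qed.

End integrals.

(** * Gamma and beta integrals *)

Section gamma_beta.
Context {R : realType}.
Local Notation mu := (@lebesgue_measure R).
Implicit Types (f g phi psi : R -> R) (A D : set R).

(** The form of all the densities met below: for phi an exponential this is a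
   gamma density, up to the constant K. *)
Definition gamma_type (K a : R) phi (x : R) : R :=
  if 0 < x then K * x `^ (a - 1) * phi x else 0.

(** The variable t stands for the share of the second summand in a sum of two
   gamma variables of shapes a and b, which explains the order of the
   parameters. *)
Definition beta_weight (a b t : R) : R := t `^ (b - 1) * (1 - t) `^ (a - 1).

(** [gamma_fun] is 0 where the gamma integral diverges; in the extended reals
   divergence remains visible, and Tonelli applies to nonnegative functions. *)
Definition egamma (a : R) : \bar R :=
  (\int[mu]_(x in `]0%R, +oo[) (x `^ (a - 1) * expR (- x))%:E)%E.

Definition ebeta (a b : R) : \bar R :=
  (\int[mu]_(t in `]0%R, 1%R[) (beta_weight a b t)%:E)%E.

Lemma measurable_gamma_type K a phi : measurable_fun setT phi ->
  measurable_fun setT (gamma_type K a phi).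
Proof.
move=> mphi; apply: measurable_fun_ifT => //.
  exact: measurable_fun_ltr.
by apply: measurable_funM => //; exact: measurable_funM.
Qed.

Lemma gamma_type_ge0 K a phi x : 0 <= K -> (forall x, 0 <= phi x) ->
  0 <= gamma_type K a phi x.
Proof.
move=> K0 phi0; rewrite /gamma_type; case: ifPn => // _.
by rewrite !mulr_ge0// powR_ge0.
Qed.

Lemma gamma_type_le0 K a phi x : x <= 0 -> gamma_type K a phi x = 0.
Proof. by rewrite /gamma_type ltNge => ->. Qed.

Lemma measurable_beta_weight a b : measurable_fun setT (beta_weight a b).
Proof.
apply: measurable_funM => //.
by apply: (measurableT_comp (measurable_powR _)); exact: measurable_funB.
Qed.

Lemma beta_weight_ge0 a b t : 0 <= beta_weight a b t.
Proof. by rewrite mulr_ge0// powR_ge0. Qed.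

Lemma measurable_expRN (c : R) : measurable_fun setT (fun x : R => expR (- (c * x))).
Proof.
apply: (measurableT_comp (@measurable_expR R)); apply: measurable_funN.
exact: measurable_funM.
Qed.

Lemma measurable_gamma_integrand a c :
  measurable_fun setT (fun x : R => x `^ (a - 1) * expR (- (c * x))).
Proof. by apply: measurable_funM => //; exact: measurable_expRN. Qed.

Lemma integral_gamma_type_mkcond K a phi A :
  (\int[mu]_(x in A `&` `]0%R, +oo[) (K * x `^ (a - 1) * phi x)%:E =
   \int[mu]_(x in A) (gamma_type K a phi x)%:E)%E.
Proof.
rewrite integral_mkcondr; apply: eq_integral => x _.
by rewrite patchE mem_setE in_itv/= andbT /gamma_type; case: ifPn.
Qed.

Lemma egammaE a : egamma a = (\int[mu]_x (gamma_type 1 a (fun x => expR (- x)) x)%:E)%E.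
Proof.
rewrite -integral_gamma_type_mkcond setTI /egamma.
by under [in RHS]eq_integral do rewrite mul1r.
Qed.

Lemma egamma_gt0 a : (0 < egamma a)%E.
Proof.
apply: integral_gt0 => //.
- by rewrite lebesgue_measure_itv/= ltry addye// ltry.
- have := @measurable_gamma_integrand a 1.
  by under eq_fun do rewrite mul1r; exact: measurable_funTS.
- by move=> x; rewrite /= in_itv/= andbT => x0; rewrite mulr_gt0 ?powR_gt0 ?expR_gt0.
Qed.

Lemma ebeta_gt0 a b : (0 < ebeta a b)%E.
Proof.
apply: integral_gt0 => //.
- by rewrite lebesgue_measure_itv_gt0.
- by apply: measurable_funTS; exact: measurable_beta_weight.
- move=> x; rewrite /= in_itv/= => /andP[x0 x1].
  by rewrite mulr_gt0// powR_gt0// subr_gt0.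
Qed.

(** Substitution u = l x. *)
Lemma egamma_scale a (l : R) : 0 < l ->
  (\int[mu]_(x in `]0%R, +oo[) (x `^ (a - 1) * expR (- (l * x)))%:E =
   (l `^ (- a))%:E * egamma a)%E.
Proof.
move=> l0.
have mexp := measurable_gamma_integrand.
have me : measurable_fun setT (fun x : R => expR (- x)).
  by have := measurable_expRN 1; under eq_fun do rewrite mul1r.
have ml : measurable_fun setT (fun x : R => gamma_type 1 a (fun x => expR (- x)) (l * x + 0)).
  have mg := measurable_gamma_type 1 a _ me.
  apply: (measurableT_comp mg).
  by apply: measurable_funD => //; exact: measurable_funM.
have := @ge0_integral_affine R l 0 (fun u => (gamma_type 1 a (fun x => expR (- x)) u)%:E) l0.
rewrite -egammaE => H.
have -> : (l `^ (- a) = (l `^ (a - 1))^-1 * l^-1)%R.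
  rewrite -powRN -[X in _ * X]powR_inv1 ?ltW// -powRD; last by rewrite (gt_eqF l0) implybT.
  by congr (_ `^ _); ring.
rewrite EFinM -muleA -H; last 2 first.
- by apply/measurable_EFinP; exact: measurable_gamma_type.
- by move=> x; rewrite lee_fin gamma_type_ge0// => y; rewrite expR_ge0.
rewrite integral_mkcond -ge0_integralZl//; last 3 first.
- exact/measurable_EFinP.
- by move=> x _; rewrite lee_fin gamma_type_ge0// => y; rewrite expR_ge0.
- by rewrite lee_fin invr_ge0 powR_ge0.
apply: eq_integral => x _; rewrite patchE mem_setE in_itv/= andbT /gamma_type addr0 pmulr_rgt0//.
case: ifPn => x0; last by rewrite mule0.
rewrite mul1r powRM ?ltW// -EFinM; congr EFin.
by rewrite !mulrA mulVf ?mul1r// gt_eqF// powR_gt0.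
Qed.

Lemma convol_gamma_type_le0 (K1 a : R) phi (K2 b : R) psi (s : R) : s <= 0 ->
  convol (gamma_type K1 a phi) (gamma_type K2 b psi) s = 0%E.
Proof.
move=> s0; apply: integral0_eq => y _.
have [y0|y0] := ltP 0 y; last by rewrite (gamma_type_le0 _ _ _ _ y0) mul0r.
by rewrite [X in (_ * X)%:E]gamma_type_le0 ?mulr0//; lra.
Qed.

(** The substitution y = s t brings the domain (0, s) of the convolution
   integral to (0, 1), and extracts a power of s. *)
Lemma convol_gamma_type (K1 a : R) phi (K2 b : R) psi (s : R) :
  0 <= K1 -> 0 <= K2 -> measurable_fun setT phi -> measurable_fun setT psi ->
  (forall x, 0 <= phi x) -> (forall x, 0 <= psi x) -> 0 < s ->
  convol (gamma_type K1 a phi) (gamma_type K2 b psi) s =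
  ((K1 * K2 * s `^ (a + b - 1))%:E * \int[mu]_(t in `]0%R, 1%R[)
     (beta_weight a b t * (phi (s * (1 - t)) * psi (s * t)))%:E)%E.
Proof.
move=> K10 K20 mphi mpsi phi0 psi0 s0.
pose F (y : R) : \bar R := (gamma_type K2 b psi y * gamma_type K1 a phi (s - y))%:E.
have F0 y : (0 <= F y)%E by rewrite lee_fin mulr_ge0// gamma_type_ge0.
have mF : measurable_fun setT F.
  apply/measurable_EFinP; apply: measurable_funM; first exact: measurable_gamma_type.
  apply: (measurableT_comp (measurable_gamma_type K1 a phi mphi)).
  exact: measurable_funB.
have := @ge0_integral_affine R s 0 F s0 mF F0.
rewrite -[X in (_ * X)%E]/(convol (gamma_type K1 a phi) (gamma_type K2 b psi) s) => H.
have -> : convol (gamma_type K1 a phi) (gamma_type K2 b psi) s =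
    (s%:E * \int[mu]_t F (s * t + 0)%R)%E.
  by rewrite H muleA -EFinM divff ?gt_eqF// mul1e.
have m1 : measurable_fun setT (fun t : R => s * t + 0).
  by apply: measurable_funD => //; exact: measurable_funM.
have mFs : measurable_fun setT (fun t : R => F (s * t + 0)%R).
  exact: (measurableT_comp mF m1).
have m2 : measurable_fun setT
    (fun t : R => beta_weight a b t * (phi (s * (1 - t)) * psi (s * t))).
  apply: measurable_funM; first exact: measurable_beta_weight.
  apply: measurable_funM.
    apply: (measurableT_comp mphi); apply: measurable_funM => //.
    exact: measurable_funB.
  by apply: (measurableT_comp mpsi); exact: measurable_funM.
rewrite -ge0_integralZl//; last by rewrite lee_fin ltW.
rewrite -[in RHS]ge0_integralZl//; last 3 first.
- by apply/measurable_EFinP; exact: measurable_funTS.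
- by move=> t _; rewrite lee_fin !mulr_ge0 ?powR_ge0.
- by rewrite lee_fin !mulr_ge0 ?powR_ge0.
rewrite [RHS]integral_mkcond.
apply: eq_integral => t _; rewrite patchE mem_setE in_itv/= /F addr0 /gamma_type pmulr_rgt0//.
have -> : (0 < s - s * t) = (t < 1) by rewrite -{1}(mulr1 s) -mulrBr pmulr_rgt0// subr_gt0.
case: ifPn => t0/=; last by rewrite mul0r !mule0.
case: ifPn => t1/=; last by rewrite !mulr0 !mule0.
have -> : s - s * t = s * (1 - t) by ring.
rewrite !powRM ?ltW ?subr_gt0// /beta_weight -!EFinM; congr EFin.
have -> : s `^ (a + b - 1) = s * s `^ (a - 1) * s `^ (b - 1).
  rewrite -{2}(powRr1 (ltW s0)) -!powRD; [|by rewrite (gt_eqF s0) implybT..].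
  by congr (_ `^ _); ring.
ring.
Qed.

(** Both sides are the total mass of the convolution of x^(a - 1) exp(- x) and
   x^(b - 1) exp(- x). *)
Lemma egammaM a b : (egamma a * egamma b = ebeta a b * egamma (a + b))%E.
Proof.
have me : measurable_fun setT (fun x : R => expR (- x)).
  by have := measurable_expRN 1; under eq_fun do rewrite mul1r.
have e0 (x : R) : 0 <= expR (- x) by rewrite expR_ge0.
pose f c := gamma_type 1 c (fun x : R => expR (- x)).
have mf c : measurable_fun setT (f c) by exact: measurable_gamma_type.
have mEf c : measurable_fun setT (fun x : R => (f c x)%:E) by exact/measurable_EFinP.
have f0 c x : 0 <= f c x by exact: gamma_type_ge0.
have := integral_convol (f a) (f b) setT (mf a) (mf b) (f0 a) (f0 b) measurableT.
have -> : (\int[mu]_y ((f b y)%:E * \int[mu]_x ((f a x)%:E * (\1_setT (x + y))%:E)) =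
   egamma a * egamma b)%E.
  under eq_integral do under eq_integral do rewrite indicT mule1.
  rewrite ge0_integralZr//; last 3 first.
  - exact: mEf.
  - by move=> y _; rewrite lee_fin.
  - by apply: integral_ge0 => x _; rewrite lee_fin.
  by rewrite -!egammaE muleC.
move=> <-; rewrite muleC egammaE -/(f (a + b)) -ge0_integralZr//; last 3 first.
- exact: mEf.
- by move=> y _; rewrite lee_fin.
- exact/ltW/ebeta_gt0.
apply: eq_integral => s _.
have [s0|s0] := ltP 0 s; last first.
  by rewrite convol_gamma_type_le0// /f gamma_type_le0// mul0e.
rewrite convol_gamma_type// /f /gamma_type s0 !mul1r EFinM -muleA; congr (_ * _)%E.
rewrite /ebeta -ge0_integralZl//; last 2 first.
- by apply/measurable_EFinP; apply: measurable_funTS; exact: measurable_beta_weight.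
- by move=> t _; rewrite lee_fin beta_weight_ge0.
apply: eq_integral => t _; rewrite -EFinM; congr EFin.
rewrite mulrC -expRD; congr (expR _ * _); ring.
Qed.

Lemma gamma_funE a : gamma_fun a = fine (egamma a). Proof. by []. Qed.

Lemma gamma_fun_gt0 a : (egamma a < +oo)%E -> 0 < gamma_fun a.
Proof. by move=> fa; rewrite gamma_funE fine_gt0// egamma_gt0. Qed.

Lemma egammaEFin a : (egamma a < +oo)%E -> egamma a = (gamma_fun a)%:E.
Proof. by move=> fa; rewrite gamma_funE fineK// ge0_fin_numE// ltW// egamma_gt0. Qed.

(** x <= 2 exp(x / 2) absorbs the extra factor x at the price of a change of
   scale. *)
Lemma egammaS_lty a : (egamma a < +oo)%E -> (egamma (a + 1) < +oo)%E.
Proof.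
move=> fa.
have l0 : (0 : R) < 2^-1 by [].
apply: (@le_lt_trans _ _ (\int[mu]_(x in `]0%R, +oo[)
    (2 * (x `^ (a - 1) * expR (- (2^-1 * x))))%:E)%E); last first.
  under eq_integral do rewrite EFinM.
  rewrite ge0_integralZl//; last 2 first.
  - by apply/measurable_EFinP; apply: measurable_funTS; exact: measurable_gamma_integrand.
  - by move=> x _; rewrite lee_fin mulr_ge0 ?powR_ge0 ?expR_ge0.
  rewrite egamma_scale// egammaEFin// -!EFinM.
  exact: ltry.
have me : measurable_fun setT (fun x : R => x `^ (a + 1 - 1) * expR (- x)).
  have := measurable_gamma_integrand (a + 1) 1.
  by under eq_fun do rewrite mul1r.
apply: ge0_le_integral => //.
- by move=> x _; rewrite lee_fin mulr_ge0 ?powR_ge0 ?expR_ge0.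
- by apply/measurable_EFinP; exact: measurable_funTS.
- apply/measurable_EFinP; apply: measurable_funTS.
  by apply: measurable_funM => //; exact: measurable_gamma_integrand.
- move=> x; rewrite /= in_itv/= andbT => x0; rewrite lee_fin.
  have -> : x `^ (a + 1 - 1) = x * x `^ (a - 1).
    rewrite -{2}(powRr1 (ltW x0)) -powRD; last by rewrite (gt_eqF x0) implybT.
    by congr (_ `^ _); ring.
  have -> : - x = - (2^-1 * x) + - (2^-1 * x) by field.
  rewrite expRD mulrA [2 * _]mulrA ler_wpM2r ?expR_ge0//.
  rewrite -mulrA mulrCA mulrC ler_wpM2r ?powR_ge0//.
  rewrite expRN ler_pdivrMr ?expR_gt0//.
  have := expR_ge1Dx (2^-1 * x); lra.
Qed.

Lemma gamma_integrable a l : 0 < l -> (egamma a < +oo)%E ->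
  mu.-integrable `]0, +oo[ (EFin \o (fun x : R => x `^ (a - 1) * expR (- (l * x)))).
Proof.
move=> l0 fa; apply/integrableP; split.
  by apply/measurable_EFinP; apply: measurable_funTS; exact: measurable_gamma_integrand.
under eq_integral do rewrite /= ger0_norm ?mulr_ge0 ?powR_ge0 ?expR_ge0//.
by rewrite egamma_scale// egammaEFin// -EFinM ltry.
Qed.

Lemma Rintegral_gamma a l : 0 < l -> (egamma a < +oo)%E ->
  \int[mu]_(x in `]0, +oo[) (x `^ (a - 1) * expR (- (l * x))) = l `^ (- a) * gamma_fun a.
Proof. by move=> l0 fa; rewrite /Rintegral egamma_scale// egammaEFin. Qed.

(** The tangent line of the exponential gives
   exp(- l x) + (l - 1) x exp(- x) >= exp(- x), with equality for l = 1. After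
   multiplication by x^(a - 1) and integration, l = 1 is thus a minimum of
   l^(- a) Gamma(a) + (l - 1) Gamma(a + 1), where the derivative vanishes. *)
Lemma gamma_funS a : (egamma a < +oo)%E -> gamma_fun (a + 1) = a * gamma_fun a.
Proof.
move=> fa; have fS := egammaS_lty a fa.
set G := gamma_fun a; set G1 := gamma_fun (a + 1).
have key l : 0 < l -> G <= l `^ (- a) * G + (l - 1) * G1.
  move=> l0.
  have i1 c (fc : (egamma c < +oo)%E) := gamma_integrable c 1 ltr01 fc.
  have G_ c : (egamma c < +oo)%E ->
      gamma_fun c = \int[mu]_(x in `]0, +oo[) (x `^ (c - 1) * expR (- (1 * x))).
    by move=> fc; rewrite Rintegral_gamma// powR1 mul1r.
  rewrite -(Rintegral_gamma a l)// /G /G1 !G_//.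
  have i2 : mu.-integrable `]0, +oo[
      (EFin \o (fun x : R => (l - 1) * (x `^ (a + 1 - 1) * expR (- (1 * x))))).
    exact: (integrableZl _ _ (i1 _ fS)).
  rewrite -RintegralZl//; last exact: i1.
  rewrite -RintegralD//; last exact: gamma_integrable.
  apply: le_Rintegral => //; first exact: i1.
    exact: (integrableD _ (gamma_integrable _ _ l0 fa) i2).
  move=> x /=; rewrite in_itv/= andbT => x0.
  have -> : x `^ (a + 1 - 1) = x * x `^ (a - 1).
    rewrite -{2}(powRr1 (ltW x0)) -powRD; last by rewrite (gt_eqF x0) implybT.
    by congr (_ `^ _); ring.
  have -> : - (l * x) = - (1 * x) + (1 - l) * x by ring.
  rewrite expRD -subr_ge0.
  rewrite [leRHS](_ : _ = x `^ (a - 1) * expR (- (1 * x)) *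
    (expR ((1 - l) * x) - (1 + (1 - l) * x))); last by ring.
  by rewrite !mulr_ge0 ?powR_ge0 ?expR_ge0// subr_ge0 expR_ge1Dx.
pose q : R -> R := (G \*: (@powR R ^~ (- a))) + (G1 \*: (id - cst 1)).
have qE l : q l = l `^ (- a) * G + (l - 1) * G1.
  by rewrite /q !fctE /= /GRing.scale/= mulrC [_ * G1]mulrC.
have dq (l : R) : 0 < l -> is_derive l 1 q (G * (- a * l `^ (- a - 1)) + G1).
  move=> l0; apply: is_deriveD.
    by apply: is_deriveZ; exact: is_derive1_powR.
  by apply: is_derive_eq; rewrite subr0 /GRing.scale/= mulr1.
have : is_derive (1 : R) 1 q 0.
  apply: (@derive1_at_min _ q 0 2 1) => //.
  - by move=> t; rewrite in_itv/= => /andP[t0 _]; exact: (@ex_derive _ _ _ _ _ _ _ (dq t t0)).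
  - by rewrite in_itv/= ltr01 ltr1n.
  move=> t; rewrite in_itv/= => /andP[t0 _].
  by rewrite !qE subrr mul0r addr0 powR1 mul1r key.
move=> /@derive_val; have /@derive_val -> /= := dq 1 ltr01.
rewrite powR1; lra.
Qed.

End gamma_beta.

(** * Functions that behave like the Laplace transform of a bounded law *)

Section mixtures.
Context {R : realType}.
Local Notation mu := (@lebesgue_measure R).
Implicit Types (f g phi psi : R -> R) (A D : set R).

Definition convexR f := forall p x y, 0 <= p <= 1 ->
  f (p * x + (1 - p) * y) <= p * f x + (1 - p) * f y.

(** Properties of phi(x) = E exp(- x Z) for a bounded nonnegative variable Z of
   mean m: exp(lam x) phi(x) is a mixture of exponentials, hence convex; the
   lower bound is the Jensen inequality; the upper bound is the expansion at 0 to
   second order. Unlike the representation by Z, they are directly transported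
   by the convolution with a gamma density. *)
Definition laplace_like (m : R) phi := [/\
  forall lam, convexR (fun x => expR (lam * x) * phi x),
  forall x, expR (- (m * x)) <= phi x,
  exists K, forall x, 0 <= x -> phi x <= 1 - m * x + K * x ^+ 2 &
  nonincreasing_fun phi].

Lemma expR_tangent (x y : R) : expR y * (1 + (x - y)) <= expR x.
Proof.
have -> : expR x = expR y * expR (x - y) by rewrite -expRD; congr expR; ring.
by rewrite ler_wpM2l ?expR_ge0 ?expR_ge1Dx.
Qed.

Lemma expRN_le_quadratic (y : R) : 0 <= y -> expR (- y) <= 1 - y + y ^+ 2.
Proof.
move=> y0; rewrite expRN -[leLHS]mul1r ler_pdivrMr ?expR_gt0//.
apply: (@le_trans _ _ ((1 - y + y ^+ 2) * (1 + y))).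
  by rewrite -subr_ge0 [leRHS](_ : _ = y ^+ 3) ?exprn_ge0//; ring.
by rewrite ler_wpM2l ?expR_ge1Dx//; nra.
Qed.

Lemma convexR_expR (c : R) : convexR (fun x => expR (c * x)).
Proof.
move=> p x y /andP[p0 p1].
have p1' : 0 <= 1 - p by lra.
set z := c * (p * x + (1 - p) * y).
have hx := ler_wpM2l p0 (expR_tangent (c * x) z).
have hy := ler_wpM2l p1' (expR_tangent (c * y) z).
apply: le_trans (lerD hx hy).
rewrite -/z [leRHS](_ : _ = expR z * (1 + (p * (c * x) + (1 - p) * (c * y) - z))); last by ring.
by rewrite [_ - z](_ : _ = 0) ?addr0 ?mulr1// /z; ring.
Qed.

Lemma convexR_le_max f u y v : convexR f -> u <= y -> y <= v ->
  f y <= Num.max (f u) (f v).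
Proof.
move=> cvx uy yv; have [vu|uv] := leP v u.
  have -> : y = v by lra.
  by rewrite le_max lexx orbT.
pose p := (v - y) / (v - u).
have p0 : 0 <= p by rewrite divr_ge0//; lra.
have p1 : p <= 1 by rewrite ler_pdivrMr; lra.
have p01 : 0 <= p <= 1 by rewrite p0.
have := cvx p u v p01.
have -> : p * u + (1 - p) * v = y by rewrite /p; field; lra.
move=> /le_trans; apply.
have h1 : f u <= Num.max (f u) (f v) by rewrite le_max lexx.
have h2 : f v <= Num.max (f u) (f v) by rewrite le_max lexx orbT.
nra.
Qed.

Lemma laplace_like_expR (c : R) : 0 <= c -> laplace_like c (fun x => expR (- (x * c))).
Proof.
move=> c0; split.
- move=> lam p x y p01.
  have := convexR_expR (lam - c) p x y p01.
  have E u : expR (lam * u) * expR (- (u * c)) = expR ((lam - c) * u).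
    by rewrite -expRD; congr expR; ring.
  by rewrite !E.
- by move=> x; rewrite mulrC.
- exists (c ^+ 2) => x x0.
  by have := expRN_le_quadratic (x * c) (mulr_ge0 x0 c0); lra.
- by move=> x y xy; rewrite ler_expR lerN2 ler_wpM2r.
Qed.

Section laplace_like_theory.
Context {m : R} {phi} (hphi : laplace_like m phi).

Lemma laplace_like_convex lam : convexR (fun x => expR (lam * x) * phi x).
Proof. by case: hphi. Qed.

Lemma laplace_like_lb x : expR (- (m * x)) <= phi x.
Proof. by case: hphi. Qed.

Lemma laplace_like_ub : exists K, forall x, 0 <= x -> phi x <= 1 - m * x + K * x ^+ 2.
Proof. by case: hphi. Qed.

Lemma laplace_like_gt0 x : 0 < phi x.
Proof. by rewrite (lt_le_trans _ (laplace_like_lb x))// expR_gt0. Qed.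

Lemma laplace_like_ge0 x : 0 <= phi x.
Proof. exact/ltW/laplace_like_gt0. Qed.

Lemma laplace_like0 : phi 0 = 1.
Proof.
apply/eqP; rewrite eq_le; have := laplace_like_lb 0.
rewrite mulr0 oppr0 expR0 => ->; rewrite andbT.
have [K /(_ 0 (lexx _))] := laplace_like_ub.
by rewrite expr0n/= !mulr0 subr0 addr0.
Qed.

Lemma laplace_like_nonincreasing : nonincreasing_fun phi.
Proof. by case: hphi. Qed.

Lemma laplace_like_le1 x : 0 <= x -> phi x <= 1.
Proof. by move=> x0; rewrite -laplace_like0; exact: laplace_like_nonincreasing. Qed.

Lemma measurable_laplace_like : measurable_fun setT phi.
Proof. exact: nonincreasing_measurable laplace_like_nonincreasing. Qed.

(** By convexity the slope of phi on [x, y] is at least its slope on [0, y],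
   itself at least - m because phi 0 = 1 and phi y >= 1 - m y. *)
Lemma laplace_like_lipschitz x y : 0 <= x -> x <= y -> phi x - phi y <= m * (y - x).
Proof.
move=> x0 xy; have [y0|y0] := ltP 0 y; last first.
  have -> : x = y by lra.
  lra.
pose p := 1 - x / y.
have p01 : 0 <= p <= 1.
  by rewrite subr_ge0 ler_pdivrMr// mul1r xy/= gerBl divr_ge0// ltW.
have := laplace_like_convex 0 p 0 y p01.
rewrite !mul0r expR0 !mul1r laplace_like0 mulr0 add0r mulr1.
have -> : (1 - p) * y = x by rewrite /p; field; lra.
move=> cvx.
have h1 : 1 - phi y <= m * y.
  have := le_trans (expR_ge1Dx _) (laplace_like_lb y); lra.
have h2 : p * (1 - phi y) <= p * (m * y) by apply: ler_wpM2l => //; case/andP: p01.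
have -> : m * (y - x) = p * (m * y) by rewrite /p; field; lra.
lra.
Qed.

Lemma laplace_like_continuous x : 0 < x -> {for x, continuous phi}.
Proof.
move=> x0.
have lip y : 0 < y -> phi x - m * `|y - x| <= phi y <= phi x + m * `|y - x|.
  move=> y0; have [xy|yx] := leP x y.
    rewrite ger0_norm ?subr_ge0//.
    have h1 := laplace_like_lipschitz x y (ltW x0) xy.
    have h2 := laplace_like_nonincreasing _ _ xy.
    by apply/andP; split; lra.
  rewrite ltr0_norm ?subr_lt0//.
  have h1 := laplace_like_lipschitz y x (ltW y0) (ltW yx).
  have h2 := laplace_like_nonincreasing _ _ (ltW yx).
  by apply/andP; split; lra.
have c1 : (fun y => `|y - x|) y @[y --> x] --> (0 : R).
  have : (fun y => y - x) y @[y --> x] --> x - x.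
    by apply: cvgB; [exact: cvg_id|exact: cvg_cst].
  by rewrite subrr => /cvg_norm; rewrite normr0.
have c2 (k : R) : phi x + k * `|y - x| @[y --> x] --> phi x.
  rewrite -[X in _ --> X]addr0 -(mulr0 k); apply: cvgD; first exact: cvg_cst.
  exact: cvgMl_tmp.
apply: (squeeze_cvgr _ (c2 (- m)) (c2 m)).
near=> y; rewrite mulNr; apply: lip.
near: y; exact: lt_nbhsr.
Unshelve. all: by end_near. Qed.

Section tilt.
Context (lam : R).
Let H x := expR (lam * x) * phi x.

Let H0 : H 0 = 1. Proof. by rewrite /H mulr0 expR0 laplace_like0 mulr1. Qed.

Lemma tilt_ge x : expR ((lam - m) * x) <= H x.
Proof.
rewrite mulrBl expRD /H ler_wpM2l ?expR_ge0//; exact: laplace_like_lb.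
Qed.

(** If m <= lam then H >= 1 = H 0, and a convex function that is minimal at 0 is
   nondecreasing on [0, +oo). *)
Lemma tilt_nondecreasing : m <= lam -> forall x y, 0 <= x -> x <= y -> H x <= H y.
Proof.
move=> mlam x y x0 xy; have [y0|y0] := ltP 0 y; last first.
  by have -> : x = y by lra.
pose p := 1 - x / y.
have p01 : 0 <= p <= 1.
  by rewrite subr_ge0 ler_pdivrMr// mul1r xy/= gerBl divr_ge0// ltW.
have := laplace_like_convex lam p 0 y p01; rewrite -/(H _) -/(H 0) -/(H y) H0 mulr0 add0r.
have -> : (1 - p) * y = x by rewrite /p; field; lra.
have Hy1 : 1 <= H y.
  apply: le_trans (tilt_ge y); rewrite -expR0 ler_expR mulr_ge0//; lra.
by rewrite -/(H x); case/andP: p01 => p0 p1; nra.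
Qed.

(** The quadratic upper bound provides x1 > 0 with H x1 < 1 = H 0. Some x between
   0 and x1 satisfies H x1 < H x, and convexity on [y, x1] then forces H y > H x
   whenever 0 < y < x. *)
Lemma tilt_decreasing_near0 : lam < m ->
  exists2 x, 0 < x & forall y, 0 < y -> y < x -> H x < H y.
Proof.
move=> lamm.
have [x1 x10 Hx1] : exists2 x1, 0 < x1 & H x1 < 1.
  have [K hK] := laplace_like_ub.
  have k0 : 0 < 2 * (`|K| + 1) by have := normr_ge0 K; lra.
  (* K x1 < m - lam, so that the quadratic term does not compensate the slope *)
  pose x1 := (m - lam) / (2 * (`|K| + 1)).
  have x10 : 0 < x1 by rewrite divr_gt0// subr_gt0.
  exists x1 => //.
  rewrite /H -[ltRHS](mulVf (lt0r_neq0 (expR_gt0 (- (lam * x1))))) expRN invrK ltr_pM2l ?expR_gt0//.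
  rewrite -expRN; apply: lt_le_trans (expR_ge1Dx _).
  apply: (le_lt_trans (hK _ (ltW x10))).
  have e : x1 * (2 * (`|K| + 1)) = m - lam by rewrite /x1; field; lra.
  have : K * x1 <= `|K| * x1 by rewrite ler_wpM2r ?ler_norm// ltW.
  nra.
(* 1 - (m - lam) x is the midpoint of 1 and H x1, and a lower bound of H x *)
pose x := (1 - H x1) / (2 * (m - lam)).
have x0 : 0 < x by rewrite divr_gt0//; lra.
have e : x * (2 * (m - lam)) = 1 - H x1 by rewrite /x; field; lra.
have Hx : H x1 < H x.
  apply: (lt_le_trans _ (tilt_ge x)); apply: (lt_le_trans _ (expR_ge1Dx _)); nra.
have xx1 : x < x1.
  rewrite ltNge; apply/negP => x1x.
  have := le_trans (expR_ge1Dx _) (tilt_ge x1); nra.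
exists x => // y y0 yx.
pose p := (x1 - x) / (x1 - y).
have d0 : 0 < x1 - y by lra.
have p0 : 0 < p by rewrite divr_gt0//; lra.
have p1 : p < 1 by rewrite ltr_pdivrMr//; lra.
have p01 : 0 <= p <= 1 by rewrite !ltW.
have := laplace_like_convex lam p y x1 p01.
have -> : p * y + (1 - p) * x1 = x by rewrite /p; field; lra.
rewrite -/(H x) -/(H y) -/(H x1); nra.
Qed.

End tilt.

End laplace_like_theory.

Section mixture.
Context (w : R -> R) (tau : R).
Local Notation I := (`]0, 1[%classic : set R).
Hypothesis mw : measurable_fun setT w.
Hypothesis w0 : forall t, 0 <= w t.
Hypothesis wI : mu.-integrable I (EFin \o w).
Hypothesis w1 : \int[mu]_(t in I) w t = 1.
Hypothesis wtau : \int[mu]_(t in I) (w t * t) = tau.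

Let E f := \int[mu]_(t in I) (w t * f t).

Lemma integrable_weighted f M : measurable_fun setT f ->
  (forall t, 0 < t < 1 -> `|f t| <= M) ->
  mu.-integrable I (EFin \o (fun t => w t * f t)).
Proof.
move=> mf fM; apply: (@le_integrable _ _ R mu I _ _ (fun t => M%:E * (w t)%:E)%E).
- exact: measurable_itv.
- apply/measurable_EFinP; apply: measurable_funTS; exact: measurable_funM.
- move=> t /=; rewrite in_itv/= => tI; rewrite lee_fin normrM (ger0_norm (w0 t)).
  rewrite mulrC normrM (ger0_norm (w0 t)) ler_wpM2r//.
  by rewrite (le_trans (fM _ tI))// ler_norm.
- exact: integrableZl.
Qed.

Lemma weighted_affine (p q : R) : E (fun t => p + q * t) = p + q * tau.
Proof.
have i1 : mu.-integrable I (EFin \o (fun t => w t * t)).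
  apply: (@integrable_weighted _ 1) => // t /andP[t0 t1].
  by rewrite ger0_norm ?ltW.
transitivity (p * \int[mu]_(t in I) w t + q * \int[mu]_(t in I) (w t * t)).
  rewrite -!RintegralZl// -RintegralD//.
  - by apply: eq_Rintegral => t _ /=; ring.
  - exact: (integrableZl _ p wI).
  - exact: (integrableZl _ q i1).
by rewrite w1 wtau mulr1.
Qed.

Lemma le_weighted f g M M' : measurable_fun setT f -> measurable_fun setT g ->
  (forall t, 0 < t < 1 -> `|f t| <= M) -> (forall t, 0 < t < 1 -> `|g t| <= M') ->
  (forall t, 0 < t < 1 -> f t <= g t) -> E f <= E g.
Proof.
move=> mf mg fM gM fg; apply: le_Rintegral => //.
- exact: integrable_weighted mf fM.
- exact: integrable_weighted mg gM.
- by move=> t /=; rewrite in_itv/= => tI; rewrite ler_wpM2l// fg.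
Qed.

Lemma weightedZ k f M : measurable_fun setT f -> (forall t, 0 < t < 1 -> `|f t| <= M) ->
  E (fun t => k * f t) = k * E f.
Proof.
move=> mf fM; rewrite /E -RintegralZl//; last exact: integrable_weighted mf fM.
by apply: eq_Rintegral => t _; rewrite mulrCA.
Qed.

Lemma weightedD f g M M' : measurable_fun setT f -> measurable_fun setT g ->
  (forall t, 0 < t < 1 -> `|f t| <= M) -> (forall t, 0 < t < 1 -> `|g t| <= M') ->
  E (fun t => f t + g t) = E f + E g.
Proof.
move=> mf mg fM gM; rewrite /E -RintegralD//.
- by apply: eq_Rintegral => t _; rewrite mulrDr.
- exact: integrable_weighted mf fM.
- exact: integrable_weighted mg gM.
Qed.

Section mixture_laplace_like.
Context (m c : R) (phi : R -> R).
Hypothesis hphi : laplace_like m phi.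
Hypothesis m0 : 0 <= m.
Hypothesis c0 : 0 <= c.

Let g x t := phi (x * (1 - t)) * expR (- (x * t * c)).

Let mg x : measurable_fun setT (g x).
Proof.
apply: measurable_funM.
  apply: (measurableT_comp (measurable_laplace_like hphi)).
  by apply: measurable_funM => //; exact: measurable_funB.
apply: (measurableT_comp (@measurable_expR R)); apply: measurable_funN.
by apply: measurable_funM => //; exact: measurable_funM.
Qed.

Let g_bounded x t : 0 < t < 1 -> `|g x t| <= phi (- `|x|) * expR (`|x| * c).
Proof.
move=> /andP[t0 t1].
rewrite /g ger0_norm ?mulr_ge0 ?expR_ge0 ?(laplace_like_ge0 hphi)//.
rewrite ler_pM ?expR_ge0 ?(laplace_like_ge0 hphi)//.
  apply: (laplace_like_nonincreasing hphi).
  rewrite lerNl -mulNr; have := ler_norm (- x); rewrite normrN => h.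
  have := normr_ge0 x; nra.
rewrite ler_expR -mulNr ler_wpM2r// -mulNr.
have := ler_norm (- x); rewrite normrN => h; have := normr_ge0 x; nra.
Qed.

(** Each property holds for the integrand at fixed t, with m (1 - t) + c t in the
   place of m, and is then integrated against w: the mean tau of w turns this
   slope into (1 - tau) m + tau c. For the two bounds, the integrand is compared
   with an affine function of t, whose integral is explicit. *)
Lemma mixture_laplace_like :
  laplace_like ((1 - tau) * m + tau * c) (fun x => E (g x)).
Proof.
have mZ k x : measurable_fun setT (fun t => k * g x t) by exact: measurable_funM.
have bZ k x t : 0 < t < 1 -> `|k * g x t| <= `|k| * (phi (- `|x|) * expR (`|x| * c)).
  by move=> tI; rewrite normrM ler_wpM2l// g_bounded.
have maff (p q : R) : measurable_fun setT (fun t : R => p + q * t).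
  by apply: measurable_funD => //; exact: measurable_funM.
have baff (p q t : R) : 0 < t < 1 -> `|p + q * t| <= `|p| + `|q|.
  move=> /andP[t0 t1]; apply: (le_trans (ler_normD _ _)); rewrite lerD2l normrM.
  by rewrite ler_piMr// gtr0_norm// ltW.
split.
- move=> lam p x y p01.
  rewrite -!(weightedZ _ _ _ (mg _) (@g_bounded _)).
  rewrite -(weightedZ p _ _ (mZ _ _) (@bZ _ _)) -(weightedZ (1 - p) _ _ (mZ _ _) (@bZ _ _)).
  set z := p * x + (1 - p) * y.
  have mZ' k l u : measurable_fun setT (fun t => k * (l * g u t)) by exact: measurable_funM.
  have bZ' k l u t : 0 < t < 1 ->
      `|k * (l * g u t)| <= `|k| * (`|l| * (phi (- `|u|) * expR (`|u| * c))).
    by move=> tI; rewrite normrM ler_wpM2l// bZ.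
  rewrite -(weightedD _ _ _ _ (mZ' _ _ _) (mZ' _ _ _) (@bZ' _ _ _) (@bZ' _ _ _)).
  apply: (le_weighted _ _ _ _ (mZ _ _) _ (@bZ _ _) _).
  + exact: measurable_funD.
  + move=> t tI; apply: (le_trans (ler_normD _ _)); apply: lerD; exact: bZ'.
  (* exp(lam x) g x t is exp(lam' s) phi s for s = x (1 - t), which is linear
     in x *)
  move=> t /andP[t0 t1].
  have t1' : 1 - t != 0 by lra.
  pose lam' := (lam - t * c) / (1 - t).
  have gE u : expR (lam * u) * g u t = expR (lam' * (u * (1 - t))) * phi (u * (1 - t)).
    rewrite /g mulrCA mulrC -expRD; congr (expR _ * _); rewrite /lam'; field.
    exact: t1'.
  rewrite (gE z) (gE x) (gE y).
  have -> : z * (1 - t) = p * (x * (1 - t)) + (1 - p) * (y * (1 - t)) by rewrite /z; ring.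
  exact: (laplace_like_convex hphi).
- move=> x.
  set m' := (1 - tau) * m + tau * c.
  pose e := expR (- (m' * x)).
  rewrite -/e (_ : e =
    E (fun t => e * (1 + m' * x - m * x) + (e * (m * x - c * x)) * t)); last first.
    by rewrite weighted_affine /m'; ring.
  apply: (le_weighted _ _ _ _ (maff _ _) (mg x) (@baff _ _) (@g_bounded x)).
  move=> t /andP[t0 t1].
  apply: (@le_trans _ _ (expR (- (m * (x * (1 - t)))) * expR (- (x * t * c)))).
    rewrite -expRD; apply: le_trans (expR_tangent _ (- (m' * x))).
    by rewrite -/e le_eqVlt; apply/orP; left; apply/eqP; ring.
  by rewrite ler_wpM2r ?expR_ge0// (laplace_like_lb hphi).
- have [K0 hK0] := laplace_like_ub hphi.
  pose K := `|K0|.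
  exists (K + c ^+ 2 + m * c) => x x0.
  (* with p, q <= 1 the two factors of the integrand,
     p q = p + q - 1 + (1 - p) (1 - q), and (1 - p) (1 - q) <= (m x) (x c) *)
  pose k2 := (K + c ^+ 2 + m * c) * x ^+ 2.
  have -> : 1 - ((1 - tau) * m + tau * c) * x + k2 =
      E (fun t => (1 - m * x + k2) + (m * x - c * x) * t).
    by rewrite weighted_affine; ring.
  apply: (le_weighted _ _ _ _ (mg x) (maff _ _) (@g_bounded x) (@baff _ _)).
  move=> t /andP[t0 t1].
  have y0 : 0 <= x * (1 - t) by rewrite mulr_ge0//; lra.
  have yx : x * (1 - t) <= x by nra.
  have z0 : 0 <= x * t * c by rewrite !mulr_ge0// ltW.
  have zx : x * t * c <= x * c by rewrite ler_wpM2r//; nra.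
  have hK : phi (x * (1 - t)) <= 1 - m * (x * (1 - t)) + K * x ^+ 2.
    apply: (le_trans (hK0 _ y0)); rewrite lerD2l.
    apply: (@le_trans _ _ (K * (x * (1 - t)) ^+ 2)).
      by rewrite ler_wpM2r ?exprn_ge0// ler_norm.
    by apply: ler_wpM2l; [exact: normr_ge0|rewrite lerXn2r// nnegrE].
  have hq : expR (- (x * t * c)) <= 1 - x * t * c + (x * c) ^+ 2.
    apply: (le_trans (expRN_le_quadratic _ z0)); rewrite lerD2l.
    by rewrite lerXn2r// ?nnegrE// mulr_ge0.
  have p1 : phi (x * (1 - t)) <= 1 by exact: (laplace_like_le1 hphi).
  have q1 : expR (- (x * t * c)) <= 1 by rewrite -expR0 ler_expR; lra.
  have p2 : 1 - phi (x * (1 - t)) <= m * x.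
    have := le_trans (expR_ge1Dx _) (laplace_like_lb hphi (x * (1 - t))).
    have := ler_wpM2l m0 yx; lra.
  have q2 : 1 - expR (- (x * t * c)) <= x * c.
    have := expR_ge1Dx (- (x * t * c)); lra.
  have pq : (1 - phi (x * (1 - t))) * (1 - expR (- (x * t * c))) <= (m * x) * (x * c).
    by apply: ler_pM => //; lra.
  rewrite /g /k2; nra.
- move=> x y xy; apply: (le_weighted _ _ _ _ (mg y) (mg x) (@g_bounded y) (@g_bounded x)).
  move=> t /andP[t0 t1]; apply: ler_pM; rewrite ?expR_ge0 ?(laplace_like_ge0 hphi)//.
    by apply: (laplace_like_nonincreasing hphi); rewrite ler_wpM2r//; lra.
  by rewrite ler_expR lerN2 ler_wpM2r// ler_wpM2r// ltW.
Qed.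

End mixture_laplace_like.
End mixture.
End mixtures.

(** * Sums of two independent variables *)

Section law_on.
Context {R : realType} {d d' : measure_display} {Omega : measurableType d}
  {T : measurableType d'} (P : probability Omega R)
  (X : {mfun Omega >-> T}) (E : set Omega).

(** The law of X restricted to the event E. The measurability of E is an argument
   because the structure of measure depends on it. *)
Definition law_on (mE : measurable E) (U : set T) : \bar R := P (X @^-1` U `&` E).

Hypothesis mE : measurable E.

Let mpre U : measurable U -> measurable (X @^-1` U `&` E).
Proof. by move=> mU; apply: measurableI => //; exact: measurable_funPTI. Qed.

Let law_on0 : law_on mE set0 = 0%E.
Proof. by rewrite /law_on preimage_set0 set0I measure0. Qed.

Let law_on_ge0 U : (0 <= law_on mE U)%E.
Proof. exact: measure_ge0. Qed.

Let law_on_additive : semi_sigma_additive (law_on mE).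
Proof.
move=> F mF tF mUF; rewrite /law_on preimage_bigcup setI_bigcupl.
apply: measure_semi_sigma_additive.
- by move=> n; exact: mpre.
- apply/trivIsetP => i j _ _ ij.
  rewrite setIACA setIid -preimage_setI.
  by move/trivIsetP : tF => /(_ i j I I ij) ->; rewrite preimage_set0 set0I.
- rewrite -setI_bigcupl -preimage_bigcup; exact: mpre.
Qed.

HB.instance Definition _ := isMeasure.Build _ _ _ (law_on mE)
  law_on0 law_on_ge0 law_on_additive.

Let law_on_finite : fin_num_fun (law_on mE).
Proof. by move=> U mU; rewrite /law_on fin_num_measure//; exact: mpre. Qed.

HB.instance Definition _ := Measure_isFinite.Build _ _ _ (law_on mE) law_on_finite.

End law_on.

Section sum_of_independent.
Context {R : realType} {d : measure_display} {Omega : measurableType d}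
  (P : probability Omega R).
Local Notation mu := (@lebesgue_measure R).

(** The event E collects what is known of other variables. The restricted law of
   the pair (X, Y) agrees on rectangles with the product of the restricted law
   of X and the law of Y, hence everywhere; integrating the sections of
   {(x, y) | x + y in U} gives the convolution. *)
Lemma independent_sum_density (X Y : {RV P >-> R}) (E : set Omega) (f g : R -> R) :
  measurable E -> measurable_fun setT f -> measurable_fun setT g ->
  (forall x, 0 <= f x) -> (forall x, 0 <= g x) ->
  (forall U, measurable U -> P (X @^-1` U `&` E) = P E * \int[mu]_(x in U) (f x)%:E)%E ->
  (forall V, measurable V -> P (Y @^-1` V) = \int[mu]_(x in V) (g x)%:E)%E ->
  (forall U V, measurable U -> measurable V ->
    P (X @^-1` U `&` (Y @^-1` V `&` E)) = P (X @^-1` U `&` E) * P (Y @^-1` V))%E ->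
  forall U, measurable U ->
  P ((fun w => X w + Y w) @^-1` U `&` E) = (P E * \int[mu]_(s in U) convol f g s)%E.
Proof.
move=> mE mf mg f0 g0 hX hY hXY U mU.
have mXY : measurable_fun setT (fun w => (X w, Y w)).
  by apply/measurable_fun_pairP; split; exact: measurable_funPT.
pose XY : {mfun Omega >-> (R * R)%type} := HB.pack (fun w => (X w, Y w))
  (isMeasurableFun.Build _ _ _ _ _ mXY).
pose m1 : {finite_measure set R -> \bar R} := law_on P X E mE.
pose m2 : {finite_measure set R -> \bar R} := distribution P Y.
pose m12 : {measure set (R * R) -> \bar R} := law_on P XY E mE.
pose B := [set p : R * R | U (p.1 + p.2)].
have mB : measurable B.
  rewrite -[B]setTI; apply: (measurable_funD _ _) => //.
have m1U : measurable_fun setT (\1_U : R -> R) by exact/measurable_indicP.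
have -> : P ((fun w => X w + Y w) @^-1` U `&` E) = m12 B by [].
have <- : (m1 \x m2)%E B = m12 B.
  apply: product_measure_unique => // A C mA mC.
  by rewrite -hXY// /m12/= /law_on setIA.
pose F (p : R * R) : \bar R := ((g p.2) * \1_U (p.1 + p.2))%:E.
have mF : measurable_fun setT F.
  apply/measurable_EFinP; apply: measurable_funM; first exact: measurableT_comp.
  by apply: (measurableT_comp m1U); exact: measurable_funD.
have F0 p : (0 <= F p)%E by rewrite lee_fin mulr_ge0.
transitivity (\int[m1]_x fubini_F mu F x)%E.
  apply: eq_integral => x _ /=.
  rewrite /m2/= /distribution /pushforward hY; last exact: measurable_xsection.
  rewrite integral_mkcond; apply: eq_integral => y _.
  rewrite patchE /F/= indicE mem_xsection /B/=.
  have -> : ((x, y) \in [set p | U (p.1 + p.2)]) = (x + y \in U).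
    by apply/idP/idP; rewrite !inE.
  by case: ifPn; rewrite ?mulr1 ?mulr0.
rewrite fubini_tonelli//.
pose J y : \bar R := (\int[mu]_x ((f x)%:E * (\1_U (x + y))%:E))%E.
have J0 y : (0 <= J y)%E.
  by apply: integral_ge0 => x _; rewrite -EFinM lee_fin mulr_ge0.
have mJ : measurable_fun setT J.
  pose G (p : R * R) : \bar R := (f p.2 * \1_U (p.2 + p.1))%:E.
  rewrite (_ : J = fubini_F mu G)//.
  apply: measurable_fun_fubini_tonelli_F; last by move=> p; rewrite lee_fin mulr_ge0.
  apply/measurable_EFinP; apply: measurable_funM; first exact: measurableT_comp.
  by apply: (measurableT_comp m1U); exact: measurable_funD.
have mgJ : measurable_fun setT (fun y => (g y)%:E * J y)%E.
  by apply: emeasurable_funM => //; exact/measurable_EFinP.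
rewrite (integral_convol f g U)// -ge0_integralZl//; last first.
  by move=> y _; apply: mule_ge0; [rewrite lee_fin|exact: J0].
apply: eq_integral => y _; rewrite /fubini_G -/(J y).
pose V := [set x | U (x + y)].
have mV : measurable V.
  rewrite -[V]setTI; exact: (measurable_funD (@measurable_id _ _ _) (measurable_cst y)).
have indV x : \1_U (x + y) = \1_V x :> R.
  by rewrite !indicE; congr (_ %:R); congr nat_of_bool; apply/idP/idP; rewrite !inE.
transitivity ((g y)%:E * m1 V)%E.
  under eq_integral do rewrite /F/= indV EFinM.
  rewrite ge0_integralZl//.
  - by rewrite integral_indic// setIT.
  - by apply/measurable_EFinP; exact/measurable_indicP.
  - by rewrite lee_fin.
rewrite /m1/= /law_on hX// muleCA; congr (_ * (_ * _))%E.
rewrite integral_mkcond; apply: eq_integral => x _.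
rewrite patchE indV indicE; case: ifPn => _; by rewrite ?mule1 ?mule0.
Qed.

End sum_of_independent.

Section gamma_convolution.
Context {R : realType}.
Local Notation mu := (@lebesgue_measure R).

(** The product of the positive numbers ebeta a b and egamma (a + b) is finite
   by [egammaM], hence so are its factors. *)
Lemma gamma_beta_lty (a b : R) : (egamma a < +oo)%E -> (egamma b < +oo)%E ->
  ((ebeta a b < +oo) /\ (egamma (a + b) < +oo))%E.
Proof.
move=> fa fb; have := egammaM a b.
rewrite (egammaEFin a fa) (egammaEFin b fb) -EFinM => h.
have b0 := ebeta_gt0 a b; have g0 := egamma_gt0 (a + b).
move: h b0 g0; case: (ebeta a b) => [x||]; case: (egamma (a + b)) => [y||] //.
- by rewrite !ltry.
- by move=> + x0 _; rewrite mulry gtr0_sg// mul1e.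
- by move=> + _ y0; rewrite mulyr gtr0_sg// mul1e.
Qed.

Definition beta_density (a b t : R) : R := (fine (ebeta a b))^-1 * beta_weight a b t.

Section beta_density_theory.
Context (a b : R) (fa : (egamma a < +oo)%E) (fb : (egamma b < +oo)%E).
Local Notation I := (`]0, 1[%classic : set R).
Let B := fine (ebeta a b).

Let ebetaE : ebeta a b = B%:E.
Proof.
have [fB _] := gamma_beta_lty a b fa fb.
by rewrite /B fineK// ge0_fin_numE// ltW// ebeta_gt0.
Qed.

Lemma beta_gt0 : 0 < B.
Proof. by rewrite -lte_fin -ebetaE ebeta_gt0. Qed.

Lemma gamma_funM : gamma_fun a * gamma_fun b = B * gamma_fun (a + b).
Proof.
have [_ fab] := gamma_beta_lty a b fa fb.
have := egammaM a b.
by rewrite ebetaE (egammaEFin a fa) (egammaEFin b fb) (egammaEFin _ fab) -!EFinM => -[].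
Qed.

Lemma measurable_beta_density : measurable_fun setT (beta_density a b).
Proof. by apply: measurable_funM => //; exact: measurable_beta_weight. Qed.

Lemma beta_density_ge0 t : 0 <= beta_density a b t.
Proof. by rewrite mulr_ge0 ?beta_weight_ge0// invr_ge0 ltW// beta_gt0. Qed.

Let integrable_beta_weight : mu.-integrable I (EFin \o beta_weight a b).
Proof.
apply/integrableP; split.
  by apply/measurable_EFinP; apply: measurable_funTS; exact: measurable_beta_weight.
under eq_integral do rewrite /= ger0_norm ?beta_weight_ge0//.
by rewrite -/(ebeta a b) ebetaE ltry.
Qed.

Lemma integrable_beta_density : mu.-integrable I (EFin \o beta_density a b).
Proof. exact: (integrableZl _ B^-1 integrable_beta_weight). Qed.

Lemma Rintegral_beta_density : \int[mu]_(t in I) beta_density a b t = 1.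
Proof.
rewrite RintegralZl//.
by rewrite mulVf// gt_eqF// beta_gt0.
Qed.

Lemma Rintegral_beta_density_id : 0 < b -> 0 < a + b ->
  \int[mu]_(t in I) (beta_density a b t * t) = b / (a + b).
Proof.
move=> b0 ab0.
have fb1 := egammaS_lty b fb.
have [fB1 _] := gamma_beta_lty a (b + 1) fa fb1.
have [_ fab] := gamma_beta_lty a b fa fb.
have E t : I t -> beta_density a b t * t = B^-1 * beta_weight a (b + 1) t.
  rewrite /= in_itv/= => /andP[t0 _]; rewrite /beta_density -mulrA /beta_weight -/B.
  have -> : t `^ (b + 1 - 1) = t * t `^ (b - 1).
    rewrite -{2}(powRr1 (ltW t0)) -powRD; last by rewrite (gt_eqF t0) implybT.
    by congr (_ `^ _); ring.
  ring.
rewrite (@eq_Rintegral _ _ _ mu I (fun t => B^-1 * beta_weight a (b + 1) t)); last first.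
  by move=> t /[!inE]; exact: E.
rewrite RintegralZl//; last first.
  apply/integrableP; split.
    by apply/measurable_EFinP; apply: measurable_funTS; exact: measurable_beta_weight.
  by under eq_integral do rewrite /= ger0_norm ?beta_weight_ge0//.
rewrite /Rintegral -/(ebeta a (b + 1)).
set B1 := fine _.
have : gamma_fun a * gamma_fun (b + 1) = B1 * gamma_fun (a + b + 1).
  have := egammaM a (b + 1); rewrite addrA.
  rewrite (egammaEFin a fa) (egammaEFin _ fb1) (egammaEFin _ (egammaS_lty _ fab)).
  have -> : ebeta a (b + 1) = B1%:E by rewrite /B1 fineK// ge0_fin_numE// ltW// ebeta_gt0.
  by rewrite -!EFinM => -[].
rewrite (gamma_funS b fb) (gamma_funS _ fab) mulrCA gamma_funM => h.
have G0 := gamma_fun_gt0 _ fab; have B0 := beta_gt0.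
apply: (@mulIf _ (gamma_fun (a + b))); first by rewrite gt_eqF.
apply: (@mulIf _ (B * (a + b))); first by rewrite mulf_neq0// gt_eqF.
transitivity (B1 * ((a + b) * gamma_fun (a + b))).
  by field; lra.
rewrite -h; field; lra.
Qed.

End beta_density_theory.

(** The new Laplace-like function averages phi(s (1 - t)) exp(- s t c) over a
   beta variable t of mean b / (a + b). *)
Lemma convol_gamma_laplace_like (K1 a m K2 b c : R) (phi : R -> R) :
  (egamma a < +oo)%E -> (egamma b < +oo)%E -> 0 < a -> 0 < b ->
  0 <= K1 -> 0 <= K2 -> 0 <= m -> 0 <= c -> laplace_like m phi ->
  exists2 phi', laplace_like ((a * m + b * c) / (a + b)) phi' &
  forall s, convol (gamma_type K1 a phi) (gamma_type K2 b (fun x => expR (- (x * c)))) s =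
    (gamma_type (K1 * K2 * (gamma_fun a * gamma_fun b / gamma_fun (a + b))) (a + b) phi' s)%:E.
Proof.
move=> fa fb a0 b0 K10 K20 m0 c0 hphi.
have ab0 : 0 < a + b by lra.
pose w := beta_density a b.
have mw : measurable_fun setT w := measurable_beta_density a b.
have w0 : forall t, 0 <= w t := beta_density_ge0 a b fa fb.
have wI := integrable_beta_density a b fa fb.
have w1 := Rintegral_beta_density a b fa fb.
have wt := Rintegral_beta_density_id a b fa fb b0 ab0.
have hpsi := laplace_like_expR c c0.
pose phi' x := \int[mu]_(t in `]0, 1[) (w t * (phi (x * (1 - t)) * expR (- (x * t * c)))).
exists phi'.
  have := @mixture_laplace_like R w _ mw w0 wI w1 wt m c phi hphi m0 c0.
  have -> // : (1 - b / (a + b)) * m + b / (a + b) * c = (a * m + b * c) / (a + b).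
  by field; rewrite gt_eqF.
move=> s; have [s0|s0] := ltP 0 s; last by rewrite convol_gamma_type_le0// gamma_type_le0.
pose g t := phi (s * (1 - t)) * expR (- (s * t * c)).
have mexp : measurable_fun setT (fun x : R => expR (- (x * c))) := measurable_laplace_like hpsi.
have mg : measurable_fun setT g.
  apply: measurable_funM.
    apply: (measurableT_comp (measurable_laplace_like hphi)).
    by apply: measurable_funM => //; exact: measurable_funB.
  by apply: (measurableT_comp mexp); exact: measurable_funM.
have g0 t : 0 <= g t by rewrite mulr_ge0 ?expR_ge0 ?(laplace_like_ge0 hphi).
have g1 t : 0 < t < 1 -> `|g t| <= 1.
  move=> /andP[t0 t1]; rewrite ger0_norm// mulr_ile1 ?expR_ge0 ?(laplace_like_ge0 hphi)//.
    by rewrite (laplace_like_le1 hphi)// mulr_ge0 ?ltW ?subr_gt0.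
  by rewrite (laplace_like_le1 hpsi)// mulr_ge0 ?ltW.
have ig := integrable_weighted w mw w0 wI g 1 mg g1.
have B0 := beta_gt0 a b fa fb; set B := fine _ in B0.
rewrite convol_gamma_type//; last 2 first.
- exact: (measurable_laplace_like hphi).
- exact: (laplace_like_ge0 hphi).
rewrite -[X in (_ * X)%E]/(\int[mu]_(t in `]0%R, 1%R[) (beta_weight a b t * g t)%:E)%E.
have -> : (\int[mu]_(t in `]0%R, 1%R[) (beta_weight a b t * g t)%:E = B%:E * (phi' s)%:E)%E.
  rewrite /phi' /Rintegral fineK; last exact: (integrable_fin_num _ ig).
  rewrite -ge0_integralZl//; last 3 first.
  - exact: (measurable_int _ ig).
  - by move=> t _; rewrite lee_fin; apply: mulr_ge0; [exact: w0|exact: g0].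
  - by rewrite lee_fin ltW.
  apply: eq_integral => t _; rewrite -EFinM; congr EFin.
  by rewrite /w /beta_density -/B -[B^-1 * _ * _]mulrA mulVKf ?gt_eqF.
rewrite -EFinM /gamma_type s0; congr EFin.
rewrite (gamma_funM a b fa fb) -/B mulfK; last first.
  by have [_ fab] := gamma_beta_lty a b fa fb; rewrite (gt_eqF (gamma_fun_gt0 _ fab)).
ring.
Qed.

End gamma_convolution.

(** * The density of a weighted sum of gamma variables *)

Section gamma_sums.
Context {R : realType} {d : measure_display} {Omega : measurableType d}
  {P : probability Omega R}.
Local Notation mu := (@lebesgue_measure R).

Lemma gamma_pdfE (a b : R) : gamma_pdf a b =
  gamma_type ((gamma_fun a)^-1 * b `^ (- a)) a (fun x => expR (- (x * b^-1))).
Proof. by []. Qed.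

(** If the gamma integral diverged, the density of X would be identically 0,
   contradicting its total mass 1. *)
Lemma gamma_distributed_lty (a b : R) (X : {RV P >-> R}) :
  gamma_distributed a b X -> (egamma a < +oo)%E.
Proof.
move=> hX; rewrite ltNge leye_eq; apply/negP => /eqP fa.
have := hX setT measurableT; rewrite probability_setT integral0_eq.
  by move/eqP; rewrite onee_eq0.
by move=> x _; rewrite /gamma_pdf gamma_funE fa/= invr0 !mul0r if_same.
Qed.

Lemma gamma_pdf_ge0 (a b x : R) : (egamma a < +oo)%E -> 0 <= gamma_pdf a b x.
Proof.
move=> fa; rewrite gamma_pdfE; apply: gamma_type_ge0 => [|y]; last exact: expR_ge0.
by rewrite mulr_ge0 ?powR_ge0// invr_ge0 ltW// gamma_fun_gt0.
Qed.

Lemma measurable_expR_div (b : R) : measurable_fun setT (fun x : R => expR (- (x * b))).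
Proof.
have := measurable_expRN b; apply: eq_measurable_fun => x _; by rewrite mulrC.
Qed.

Lemma measurable_gamma_pdf (a b : R) : measurable_fun setT (gamma_pdf a b).
Proof. rewrite gamma_pdfE; apply: measurable_gamma_type; exact: measurable_expR_div. Qed.

Lemma gamma_distributed_scale (a b : R) (Y : {RV P >-> R}) : 0 < b ->
  gamma_distributed a 1 Y -> forall V, measurable V ->
  P ((fun w => b * Y w) @^-1` V) = (\int[mu]_(x in V) (gamma_pdf a b x)%:E)%E.
Proof.
move=> b0 hY V mV.
have fa := gamma_distributed_lty a 1 Y hY.
pose V' := [set x : R | V (b * x)].
have mV' : measurable V'.
  rewrite -[V']setTI; exact: (measurable_funM (measurable_cst b) (@measurable_id _ _ _)).
have -> : P ((fun w => b * Y w) @^-1` V) = distribution P Y V' by [].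
rewrite (hY V' mV') integral_mkcond [RHS]integral_mkcond.
pose F (u : R) : \bar R := (gamma_pdf a b u * \1_V u)%:E.
have m1V : measurable_fun setT (\1_V : R -> R) by exact/measurable_indicP.
have mF : measurable_fun setT (fun u => gamma_pdf a b u * \1_V u).
  by apply: measurable_funM => //; exact: measurable_gamma_pdf.
have mFb : measurable_fun setT (fun u => gamma_pdf a b (b * u + 0) * \1_V (b * u + 0)).
  apply: (measurableT_comp mF).
  by apply: measurable_funD => //; exact: measurable_funM.
have F0 u : (0 <= F u)%E by rewrite lee_fin mulr_ge0// gamma_pdf_ge0.
have mEF : measurable_fun setT F by exact/measurable_EFinP.
have H := ge0_integral_affine b 0 F b0 mEF F0.
transitivity (\int[mu]_u F u)%E; last first.
  apply: eq_integral => u _; rewrite patchE /F indicE.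
  by case: ifPn => _; rewrite ?mulr1 ?mulr0.
have bV : b * b^-1 = 1 by rewrite divff ?gt_eqF.
rewrite -[RHS]mul1e -bV EFinM -muleA -H.
rewrite -ge0_integralZl//; last 2 first.
- exact/measurable_EFinP.
- by rewrite lee_fin ltW.
apply: eq_integral => x _; rewrite patchE /F addr0.
have -> : \1_V (b * x) = \1_V' x :> R.
  by rewrite !indicE; congr (_ %:R); congr nat_of_bool; apply/idP/idP; rewrite !inE.
rewrite indicE; case: ifPn => _; last by rewrite mulr0 mule0.
rewrite mulr1 -EFinM; congr EFin.
rewrite /gamma_pdf pmulr_rgt0//; have [x0|x0] := ltP 0 x; last by rewrite mulr0.
rewrite bV powR1 mulr1 divr1 (mulrC b x) mulfK ?gt_eqF// powRM ?ltW//.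
have -> : b `^ (- a) = b^-1 * (b `^ (a - 1))^-1.
  rewrite -powRN -(powR_inv1 (ltW b0)) -powRD; last by rewrite (gt_eqF b0) implybT.
  by congr (_ `^ _); ring.
have hb : b `^ (a - 1) != 0 by rewrite gt_eqF// powR_gt0.
have hG : gamma_fun a != 0 by rewrite gt_eqF// gamma_fun_gt0.
by field; rewrite hb hG gt_eqF.
Qed.

Section sum.
Context {I : finType} (alpha b : I -> R) (S_ : I -> {RV P >-> R}).
Hypothesis alpha0 : forall i, 0 < alpha i.
Hypothesis b0 : forall i, 0 < b i.
Hypothesis indep : independent_RVs S_.
Hypothesis gammaS : forall i, gamma_distributed (alpha i) 1 (S_ i).

Definition joint_event (J : {set I}) (A : I -> set R) : set Omega :=
  \bigcap_(i in [set` J]) (S_ i @^-1` A i).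

Definition shape (s : seq I) : R := \sum_(i <- s) alpha i.
Definition scales (s : seq I) : R := \prod_(i <- s) b i `^ alpha i.

(** The mean of sum_i D_i / b_i, where D has the Dirichlet law of parameters
   alpha_i. *)
Definition rate (s : seq I) : R := (\sum_(i <- s) alpha i / b i) / shape s.

Definition weighted_sum (s : seq I) (w : Omega) : R := \sum_(i <- s) b i * S_ i w.

Lemma measurable_weighted_sum s : measurable_fun setT (weighted_sum s).
Proof.
apply: measurable_sum => i; apply: measurable_funM => //.
Qed.

Lemma measurable_joint_event (J : {set I}) A : (forall i, i \in J -> measurable (A i)) ->
  measurable (joint_event J A).
Proof.
move=> mA; apply: fin_bigcap_measurable => // i /= iJ.
by apply: measurable_funPTI; exact: mA.
Qed.

Lemma joint_event_setU1 i (J : {set I}) A V : i \notin J ->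
  joint_event (i |: J) (fun k => if k == i then V else A k) = S_ i @^-1` V `&` joint_event J A.
Proof.
move=> iJ; apply/seteqP; split => w.
  move=> h; split.
    by have := h i; rewrite /= setU11 eqxx; apply.
  move=> k /= kJ; have := h k; rewrite /= in_setU1 kJ orbT.
  have -> : (k == i) = false by apply: contraNF iJ => /eqP <-.
  exact.
move=> [hi hJ] k /=; rewrite in_setU1; case: eqVneq => [->//|ki /= kJ].
exact: hJ.
Qed.

Lemma independent_joint_event i (J : {set I}) A V : i \notin J -> measurable V ->
  (forall j, j \in J -> measurable (A j)) ->
  P (S_ i @^-1` V `&` joint_event J A) = (P (S_ i @^-1` V) * P (joint_event J A))%E.
Proof.
move=> iJ mV mA; rewrite -joint_event_setU1// !indep//; last first.
  by move=> k; rewrite in_setU1; case: eqVneq => //= _; exact: mA.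
rewrite big_setU1//= eqxx; congr (_ * _)%E.
apply: eq_bigr => k kJ; have -> // : (k == i) = false.
by apply: contraNF iJ => /eqP <-.
Qed.

Lemma shape_gt0 i s : 0 < shape (i :: s).
Proof.
rewrite /shape big_cons ltr_pwDl//; apply: sumr_ge0 => j _; exact: ltW.
Qed.

Lemma rate_ge0 s : 0 <= rate s.
Proof.
rewrite /rate divr_ge0//; apply: sumr_ge0 => j _; last exact: ltW.
by rewrite divr_ge0// ltW.
Qed.

Lemma scales_gt0 s : 0 < scales s.
Proof. by apply: prodr_gt0 => j _; exact: powR_gt0. Qed.

(** The events on the remaining variables are part of the induction hypothesis:
   the independence assumption deals with single variables, and including the
   next one in J is what makes it independent of the partial sum. *)
Lemma weighted_sum_density i s : uniq (i :: s) ->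
  (egamma (shape (i :: s)) < +oo)%E /\
  exists2 phi, laplace_like (rate (i :: s)) phi &
  forall (J : {set I}) A, (forall j, j \in J -> measurable (A j)) ->
    (forall j, j \in J -> j \notin i :: s) ->
  forall U, measurable U ->
    (P (weighted_sum (i :: s) @^-1` U `&` joint_event J A) =
    P (joint_event J A) * \int[mu]_(x in U)
     (gamma_type (gamma_fun (shape (i :: s)) * scales (i :: s))^-1 (shape (i :: s)) phi x)%:E)%E.
Proof.
elim: s i => [|j s IH] i.
  move=> _.
  have fi := gamma_distributed_lty _ _ _ (gammaS i).
  have shapeE : shape [:: i] = alpha i by rewrite /shape big_seq1.
  rewrite shapeE; split => //.
  exists (fun x => expR (- (x * (b i)^-1))).
    rewrite /rate shapeE big_seq1 mulrC mulKf ?gt_eqF//.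
    by apply: laplace_like_expR; rewrite invr_ge0 ltW.
  move=> J A mA hJ U mU.
  have iJ : i \notin J by apply/negP => /hJ; rewrite mem_head.
  pose V := [set x : R | U (b i * x)].
  have mV : measurable V.
    rewrite -[V]setTI; exact: (measurable_funM (measurable_cst (b i)) (@measurable_id _ _ _)).
  have -> : weighted_sum [:: i] @^-1` U = S_ i @^-1` V.
    by apply/seteqP; split => w; rewrite /weighted_sum /= big_seq1.
  rewrite independent_joint_event// muleC; congr (_ * _)%E.
  rewrite -[LHS]/(P ((fun w => b i * S_ i w) @^-1` U)) (gamma_distributed_scale (alpha i))//.
  apply: eq_integral => x _; rewrite gamma_pdfE; congr (gamma_type _ _ _ _)%:E.
  by rewrite /scales big_seq1 invfM powRN.
move=> /= /andP[ijs ujs]; have [fs [phi hphi dphi]] := IH j ujs.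
set s' := j :: s in ijs fs hphi dphi *.
have fi := gamma_distributed_lty _ _ _ (gammaS i).
have shapeE : shape (i :: s') = shape s' + alpha i by rewrite /shape big_cons addrC.
have s0 : 0 < shape s' by exact: shape_gt0.
have [_ fsi] := gamma_beta_lty _ _ fs fi.
rewrite shapeE; split => //.
pose K1 := (gamma_fun (shape s') * scales s')^-1.
pose K2 := (gamma_fun (alpha i))^-1 * b i `^ (- alpha i).
have G1 := gamma_fun_gt0 _ fs.
have G2 := gamma_fun_gt0 _ fi.
have G3 := gamma_fun_gt0 _ fsi.
have B0 := scales_gt0 s'.
have bi0 : 0 < b i `^ alpha i by exact: powR_gt0.
have K10 : 0 <= K1 by rewrite invr_ge0; exact: ltW (mulr_gt0 G1 B0).
have K20 : 0 <= K2.
  by apply: mulr_ge0; [rewrite invr_ge0; exact: ltW G2|exact: powR_ge0].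
have c0 : 0 <= (b i)^-1 by rewrite invr_ge0 ltW.
have [phi' hphi' convE] := convol_gamma_laplace_like K1 _ _ K2 _ _ phi fs fi s0 (alpha0 i)
  K10 K20 (rate_ge0 s') c0 hphi.
exists phi'.
  have -> // : rate (i :: s') = (shape s' * rate s' + alpha i * (b i)^-1) / (shape s' + alpha i).
  by rewrite /rate shapeE big_cons addrC [shape s' * _]mulrC divfK// gt_eqF.
move=> J A mA hJ U mU.
have iJ : i \notin J by apply/negP => /hJ; rewrite mem_head.
have hJ' k : k \in J -> k \notin s'.
  by move=> /hJ; rewrite in_cons negb_or => /andP[].
pose X : {RV P >-> R} := HB.pack (weighted_sum s')
  (isMeasurableFun.Build _ _ _ _ _ (measurable_weighted_sum s')).
have mY : measurable_fun setT (fun w => b i * S_ i w) by exact: measurable_funM.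
pose Y : {RV P >-> R} := HB.pack (fun w => b i * S_ i w) (isMeasurableFun.Build _ _ _ _ _ mY).
have -> : weighted_sum (i :: s') = (fun w => X w + Y w).
  by apply/funext => w; rewrite /weighted_sum big_cons addrC.
have hY V : measurable V -> (P (Y @^-1` V) = \int[mu]_(x in V) (gamma_pdf (alpha i) (b i) x)%:E)%E.
  exact: gamma_distributed_scale.
have hX V : measurable V -> P (X @^-1` V `&` joint_event J A) =
    (P (joint_event J A) * \int[mu]_(x in V) (gamma_type K1 (shape s') phi x)%:E)%E.
  by move=> mV; exact: dphi.
rewrite (independent_sum_density P X Y (joint_event J A)
  (gamma_type K1 (shape s') phi) (gamma_pdf (alpha i) (b i)))//.
- congr (_ * _)%E; apply: eq_integral => x _.
  rewrite gamma_pdfE convE; congr (gamma_type _ _ _ _)%:E.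
  have -> : scales (i :: s') = b i `^ alpha i * scales s' by rewrite /scales big_cons.
  rewrite /K1 /K2 powRN; field.
  by rewrite (gt_eqF G1) (gt_eqF G2) (gt_eqF G3) (gt_eqF B0) (gt_eqF bi0).
- exact: measurable_joint_event.
- by apply: measurable_gamma_type; exact: measurable_laplace_like hphi.
- exact: measurable_gamma_pdf.
- by move=> x; apply: gamma_type_ge0 => // y; exact: laplace_like_ge0 hphi _.
- by move=> x; exact: gamma_pdf_ge0.
move=> V W mV mW.
pose W' := [set x : R | W (b i * x)].
have mW' : measurable W'.
  rewrite -[W']setTI; exact: (measurable_funM (measurable_cst (b i)) (@measurable_id _ _ _)).
have -> : Y @^-1` W = S_ i @^-1` W' by [].
rewrite hX// -(joint_event_setU1 i J A W')// dphi//.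
- rewrite joint_event_setU1// independent_joint_event//.
  by rewrite -muleA muleC -muleA [X in (_ * X)%E]muleC.
- by move=> k; rewrite in_setU1; case: eqVneq => //= _; exact: mA.
- by move=> k; rewrite in_setU1 => /orP[/eqP -> //|]; exact: hJ'.
Qed.

End sum.
End gamma_sums.

(** * Orders in terms of the ratio of the densities *)

Section pdf_facts.
Context {R : realType} {d : measure_display} {Omega : measurableType d}
  {P : probability Omega R}.
Local Notation mu := (@lebesgue_measure R).
Implicit Types (X : {RV P >-> R}) (f g : R -> R).

Lemma is_pdf_ge0 X f : is_pdf X f -> forall x, 0 <= f x.
Proof.
move=> [_ f0 fp _ _] x; have [x0|x0] := ltP 0 x; first by rewrite ltW// fp.
by rewrite f0.
Qed.

(** The orders are stated for some pdfs of X and Y; uniqueness allows to work with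
   explicit ones. *)
Lemma is_pdf_unique X f g : is_pdf X f -> is_pdf X g -> forall x, 0 < x -> f x = g x.
Proof.
suff le f' g' : is_pdf X f' -> is_pdf X g' -> forall x, 0 < x -> g' x <= f' x.
  by move=> hf hg x x0; apply/eqP; rewrite eq_le !le.
move=> hf hg x x0.
have [mf _ _ cf df] := hf; have [mg _ _ cg dg] := hg.
have xI : x \in `]0, +oo[ by rewrite in_itv/= x0.
apply: continuous_density_le => //.
- exact: is_pdf_ge0 hf.
- exact: cf.
- exact: cg.
- by rewrite -(df setT measurableT) probability_setT ltry.
- by move=> A mA; rewrite -df// -dg.
Qed.

Let probability_fin X A : measurable A -> distribution P X A \is a fin_num.
Proof. by move=> mA; rewrite fin_num_measure. Qed.

Lemma fine_cdfD X x : fine (cdf X x) + fine (ccdf X x) = 1.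
Proof.
rewrite -fineD ?probability_fin//.
by rewrite cdf_ccdf_1.
Qed.

Lemma le_ccdfE d' (Omega' : measurableType d') (P' : probability Omega' R)
    (X : {RV P >-> R}) (Y : {RV P' >-> R}) x :
  (ccdf X x <= ccdf Y x)%E = (fine (ccdf X x) <= fine (ccdf Y x)).
Proof.
rewrite -[in LHS](@fineK _ (ccdf X x)) ?fin_num_measure//.
by rewrite -[in LHS](@fineK _ (ccdf Y x)) ?fin_num_measure// lee_fin.
Qed.

Lemma fine_ccdf_le1 X x : fine (ccdf X x) <= 1.
Proof. by rewrite -(fine_cdfD X x) lerDr fine_ge0// cdf_ge0. Qed.

Lemma is_pdf_cdf_gt0 X f x : is_pdf X f -> 0 < x -> 0 < fine (cdf X x).
Proof.
move=> hX x0; have [mf _ fp _ df] := hX.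
rewrite fine_gt0//; apply/andP; split; last by rewrite ltey_eq fin_num_measure.
rewrite /cdf df//.
apply: (@lt_le_trans _ _ (\int[mu]_(y in `]0%R, x]) (f y)%:E)%E).
  apply: integral_gt0 => //.
  - exact: lebesgue_measure_itv_gt0.
  - exact: measurable_funTS.
  - by move=> y; rewrite /= in_itv/= => /andP[y0 _]; exact: fp.
apply: ge0_subset_integral => //.
- by apply/measurable_EFinP; exact: measurable_funTS.
- by move=> y _; rewrite lee_fin (is_pdf_ge0 _ _ hX).
- by move=> y; rewrite /= !in_itv/= => /andP[].
Qed.

Lemma is_pdf_ccdf_gt0 X f x : is_pdf X f -> 0 < x -> 0 < fine (ccdf X x).
Proof.
move=> hX x0; have [mf _ fp _ df] := hX.
rewrite fine_gt0//; apply/andP; split; last by rewrite ltey_eq fin_num_measure.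
rewrite /ccdf df//.
apply: integral_gt0 => //.
- by rewrite lebesgue_measure_itv/= ltry addye// ltry.
- exact: measurable_funTS.
- by move=> y; rewrite /= in_itv/= andbT => xy; apply: fp; exact: lt_trans xy.
Qed.

Lemma is_pdf_cdf0 X f : is_pdf X f -> fine (cdf X 0) = 0.
Proof.
move=> [_ f0 _ _ df]; rewrite /cdf df// integral0_eq// => y.
by rewrite /= in_itv/= => /f0 ->.
Qed.

End pdf_facts.

Section density_ratio.
Context {R : realType}.
Context {d : measure_display} {Omega : measurableType d} {P : probability Omega R}.
Context {d' : measure_display} {Omega' : measurableType d'} {P' : probability Omega' R}.
Local Notation mu := (@lebesgue_measure R).
Context {S : {RV P >-> R}} {T : {RV P' >-> R}} {f h : R -> R}.
Hypothesis pdfT : is_pdf T f.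
Hypothesis pdfS : is_pdf S (fun x => f x * h x).

Let f_gt0 x : 0 < x -> 0 < f x. Proof. by case: pdfT => _ _ fp _ _; exact: fp. Qed.
Let f_ge0 x : 0 <= f x. Proof. exact: is_pdf_ge0 pdfT x. Qed.
Let f_le0 x : x <= 0 -> f x = 0. Proof. by case: pdfT => _ f0 _ _ _; exact: f0. Qed.
Let mf : measurable_fun setT f. Proof. by case: pdfT. Qed.
Let mfh : measurable_fun setT (fun x => f x * h x). Proof. by case: pdfS. Qed.
Let fh_ge0 x : 0 <= f x * h x. Proof. exact: is_pdf_ge0 pdfS x. Qed.

Lemma ratio_gt0 x : 0 < x -> 0 < h x.
Proof.
move=> x0; have : 0 < f x * h x by case: pdfS => _ _ fp _ _; exact: fp.
by rewrite pmulr_rgt0// f_gt0.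
Qed.

Let probSE (A : set R) : measurable A -> distribution P S A = (\int[mu]_(x in A) (f x * h x)%:E)%E.
Proof. by case: pdfS => _ _ _ _; apply. Qed.

Let probTE (A : set R) (k : R) : measurable A -> 0 <= k ->
  (k%:E * distribution P' T A)%E = (\int[mu]_(x in A) (k * f x)%:E)%E.
Proof.
move=> mA k0; case: pdfT => _ _ _ _ -> //.
rewrite -ge0_integralZl//.
- by apply/measurable_EFinP; exact: measurable_funTS.
- by move=> x _; rewrite lee_fin.
Qed.

Let mEF (A : set R) (g : R -> R) : measurable_fun setT g -> measurable_fun A (fun x => (g x)%:E).
Proof. by move=> mg; apply/measurable_EFinP; exact: measurable_funTS. Qed.

Lemma ratio_ub (A : set R) (k : R) : measurable A -> 0 <= k ->
  (forall x, A x -> 0 < x -> h x <= k) ->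
  fine (distribution P S A) <= k * fine (distribution P' T A).
Proof.
move=> mA k0 hk.
have -> : k * fine (distribution P' T A) = fine (k%:E * distribution P' T A)%E.
  by rewrite fineM// fin_num_measure.
apply: fine_le; rewrite ?fin_num_measure ?fin_numM// ?fin_num_measure//.
rewrite probSE// probTE//; apply: ge0_le_integral => //.
- by move=> x _; rewrite lee_fin.
- exact: mEF.
- by apply: mEF; exact: measurable_funM.
move=> x Ax; rewrite lee_fin; have [x0|x0] := ltP 0 x; last by rewrite f_le0// mul0r mulr0.
by rewrite mulrC ler_wpM2r// hk.
Qed.

Lemma ratio_lb (A : set R) (k : R) : measurable A -> 0 <= k ->
  (forall x, A x -> 0 < x -> k <= h x) ->
  k * fine (distribution P' T A) <= fine (distribution P S A).
Proof.
move=> mA k0 hk.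
have -> : k * fine (distribution P' T A) = fine (k%:E * distribution P' T A)%E.
  by rewrite fineM// fin_num_measure.
apply: fine_le; rewrite ?fin_num_measure ?fin_numM// ?fin_num_measure//.
rewrite probSE// probTE//; apply: ge0_le_integral => //.
- by move=> x _; rewrite lee_fin mulr_ge0.
- by apply: mEF; exact: measurable_funM.
- exact: mEF.
move=> x Ax; rewrite lee_fin; have [x0|x0] := ltP 0 x; last by rewrite f_le0// mul0r mulr0.
by rewrite mulrC ler_wpM2l// hk.
Qed.

(** The difference of the two sides is the integral of f (h - h x) over (0, x]. *)
Lemma ratio_lt_cdf x : 0 < x -> (forall y, 0 < y -> y < x -> h x < h y) ->
  h x * fine (cdf T x) < fine (cdf S x).
Proof.
move=> x0 hx; have hx0 := ratio_gt0 x x0.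
have mA : measurable (`]-oo, x] : set R) by exact: measurable_itv.
pose A := (`]-oo, x]%classic : set R).
have d0 y : A y -> 0 <= f y * (h y - h x).
  rewrite /A/= in_itv/= => yx; have [y0|y0] := ltP 0 y; last by rewrite f_le0// mul0r.
  rewrite mulr_ge0// subr_ge0; move: yx; rewrite le_eqVlt => /orP[/eqP ->//|yx].
  by rewrite ltW// hx.
have md : measurable_fun setT (fun y => f y * (h y - h x)).
  have -> : (fun y => f y * (h y - h x)) = (fun y => f y * h y - h x * f y).
    by apply/funext => y; ring.
  by apply: measurable_funB => //; exact: measurable_funM.
have dgt : (0 < \int[mu]_(y in A) (f y * (h y - h x))%:E)%E.
  apply: (@lt_le_trans _ _ (\int[mu]_(y in `]0%R, x[) (f y * (h y - h x))%:E)%E).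
    apply: integral_gt0 => //.
    - exact: lebesgue_measure_itv_gt0.
    - exact: measurable_funTS.
    - move=> y; rewrite /= in_itv/= => /andP[y0 yx].
      by rewrite mulr_gt0 ?f_gt0// subr_gt0 hx.
  apply: ge0_subset_integral => //; first exact: mEF.
  by move=> y; rewrite /A/= !in_itv/= => /andP[_ /ltW].
have E : distribution P S A = (((h x)%:E * distribution P' T A) +
    \int[mu]_(y in A) (f y * (h y - h x))%:E)%E.
  rewrite probTE ?ltW// probSE// -ge0_integralD//.
  - by apply: eq_integral => y _; rewrite -EFinD; congr EFin; ring.
  - by move=> y _; rewrite lee_fin mulr_ge0// ltW.
  - by apply: mEF; exact: measurable_funM.
  - exact: mEF.
have -> : h x * fine (cdf T x) = fine ((h x)%:E * distribution P' T A)%E.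
  by rewrite fineM// fin_num_measure.
apply: fine_lt; rewrite ?fin_num_measure ?fin_numM// ?fin_num_measure//.
rewrite [ltRHS]E lteDl// fin_numM// fin_num_measure//.
Qed.

Lemma ratio_ccdf_ge x : 0 < x -> (forall y, x <= y -> h x <= h y) ->
  h x * fine (ccdf T x) <= fine (ccdf S x).
Proof.
move=> x0 hx; apply: ratio_lb => //; first by rewrite ltW// ratio_gt0.
by move=> y; rewrite /= in_itv/= andbT => /ltW xy _; exact: hx.
Qed.

Lemma ratio_cdf_le x k : 0 <= k -> (forall y, 0 < y -> y <= x -> h y <= k) ->
  fine (cdf S x) <= k * fine (cdf T x).
Proof.
move=> k0 hx; apply: ratio_ub => //.
by move=> y; rewrite /= in_itv/= => yx y0; exact: hx.
Qed.

Lemma ratio_cdf_ge x k : 0 <= k -> (forall y, 0 < y -> y <= x -> k <= h y) ->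
  k * fine (cdf T x) <= fine (cdf S x).
Proof.
move=> k0 hx; apply: ratio_lb => //.
by move=> y; rewrite /= in_itv/= => yx y0; exact: hx.
Qed.

Lemma hr_le_ratioP : hr_le T S <->
  forall x, 0 < x -> h x * fine (ccdf T x) <= fine (ccdf S x).
Proof.
have eqv x : 0 < x -> (f x * h x / fine (ccdf S x) <= f x / fine (ccdf T x)) =
    (h x * fine (ccdf T x) <= fine (ccdf S x)).
  move=> x0; rewrite -mulrA ler_pM2l ?f_gt0//.
  have GT := is_pdf_ccdf_gt0 _ _ x pdfT x0; have GS := is_pdf_ccdf_gt0 _ _ x pdfS x0.
  by rewrite ler_pdivrMr// mulrC ler_pdivlMr.
split=> [[f1 [g1 [p1 p2 H]]] x x0|H].
  rewrite -eqv//; have := H x x0.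
  by rewrite (is_pdf_unique _ _ _ p1 pdfT)// (is_pdf_unique _ _ _ p2 pdfS).
by exists f, (fun x => f x * h x); split => // x x0; rewrite eqv// H.
Qed.

Lemma rh_le_ratioP : rh_le T S <->
  forall x, 0 < x -> fine (cdf S x) <= h x * fine (cdf T x).
Proof.
have eqv x : 0 < x -> (f x / fine (cdf T x) <= f x * h x / fine (cdf S x)) =
    (fine (cdf S x) <= h x * fine (cdf T x)).
  move=> x0; rewrite -mulrA ler_pM2l ?f_gt0//.
  have GT := is_pdf_cdf_gt0 _ _ x pdfT x0; have GS := is_pdf_cdf_gt0 _ _ x pdfS x0.
  by rewrite ler_pdivlMr// mulrC ler_pdivrMr.
split=> [[f1 [g1 [p1 p2 H]]] x x0|H].
  rewrite -eqv//; have := H x x0.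
  by rewrite (is_pdf_unique _ _ _ p1 pdfT)// (is_pdf_unique _ _ _ p2 pdfS).
by exists f, (fun x => f x * h x); split => // x x0; rewrite eqv// H.
Qed.

Lemma lr_le_ratioP : lr_le T S <-> forall x y, 0 < x -> x <= y -> h x <= h y.
Proof.
have rE x : 0 < x -> f x / (f x * h x) = (h x)^-1.
  by move=> x0; rewrite invfM mulrA divff ?mul1r// gt_eqF// f_gt0.
split=> [[f1 [g1 [p1 p2 H]]] x y x0 xy|H].
  have y0 : 0 < y by exact: lt_le_trans xy.
  have := H x y x0 xy.
  rewrite !(is_pdf_unique _ _ _ p1 pdfT)// !(is_pdf_unique _ _ _ p2 pdfS)// !rE//.
  by rewrite lef_pV2// posrE ratio_gt0.
exists f, (fun x => f x * h x); split => // x y x0 xy.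
have y0 : 0 < y by exact: lt_le_trans xy.
by rewrite !rE// lef_pV2 ?posrE ?ratio_gt0// H.
Qed.

Lemma st_le_ratioP : st_le T S <-> forall x, 0 < x -> fine (cdf S x) <= fine (cdf T x).
Proof.
have eqv x : (ccdf T x <= ccdf S x)%E = (fine (cdf S x) <= fine (cdf T x)).
  rewrite le_ccdfE; have e1 := fine_cdfD T x; have e2 := fine_cdfD S x.
  by apply/idP/idP => ?; lra.
split=> [H x _|H x]; first by rewrite -eqv.
rewrite eqv; have [x0|x0] := ltP 0 x; first exact: H.
have := ratio_cdf_le x 0 (lexx 0); rewrite mul0r => /(_ _)/le_trans -> //.
  by move=> y y0 yx; have := lt_le_trans y0 (le_trans yx x0); rewrite ltxx.
by rewrite fine_ge0// cdf_ge0.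
Qed.


(** If h u < h x for some u > x, then h x <= max (h 0) (h u) forces h x <= h 0. *)
Lemma ratio_quasi_convex_dichotomy : convexR h -> h 0 <= 1 -> forall x, 0 < x ->
  (forall y, x <= y -> h x <= h y) \/ h x <= 1.
Proof.
move=> cvx h0 x x0.
have [|/existsNP[u /not_implyP[xu /negP]]] := pselect (forall y, x <= y -> h x <= h y).
  by left.
rewrite -ltNge => hux; right; apply: le_trans h0.
by have := convexR_le_max _ _ _ _ cvx (ltW x0) xu; rewrite le_max [h x <= h u]leNgt hux orbF.
Qed.

Lemma ratio_le1 : convexR h -> h 0 <= 1 -> forall x, h x <= 1 ->
  forall y, 0 < y -> y <= x -> h y <= 1.
Proof.
move=> cvx h0 x hx y y0 yx; apply: (le_trans (convexR_le_max _ _ _ _ cvx (ltW y0) yx)).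
by rewrite ge_max h0.
Qed.

(** Where h x <= 1, the bound h <= 1 on (0, x] compares the distribution functions
   instead of the tails: P(S > x) >= P(T > x) >= h x P(T > x). *)
Lemma hr_le_of_convex : convexR h -> h 0 <= 1 -> hr_le T S.
Proof.
move=> cvx h0; apply/hr_le_ratioP => x x0.
have [hx|hx] := ratio_quasi_convex_dichotomy cvx h0 x x0.
  exact: ratio_ccdf_ge.
have := ratio_cdf_le x 1 ler01 (ratio_le1 cvx h0 x hx).
have := fine_cdfD T x; have := fine_cdfD S x.
have G := is_pdf_ccdf_gt0 _ _ x pdfT x0.
rewrite mul1r; nra.
Qed.

Lemma st_le_of_convex : convexR h -> h 0 <= 1 -> st_le T S.
Proof.
move=> cvx h0; apply/st_le_ratioP => x x0.
have [hx1|hx1] := leP (h x) 1.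
  by have := ratio_cdf_le x 1 ler01 (ratio_le1 cvx h0 x hx1); rewrite mul1r.
have [hx|] := ratio_quasi_convex_dichotomy cvx h0 x x0; last by rewrite leNgt hx1.
have := ratio_ccdf_ge x x0 hx.
have := fine_cdfD T x; have := fine_cdfD S x.
have G := is_pdf_ccdf_gt0 _ _ x pdfT x0.
nra.
Qed.

End density_ratio.

(** * Orders when the ratio is a tilted Laplace-like function *)

Section orders.
Context {R : realType}.
Context {d : measure_display} {Omega : measurableType d} {P : probability Omega R}.

Lemma le1_of_cvg_at_right0 (c k : R) (v : R -> R) : v x @[x --> (0:R)^'+] --> (1 : R) ->
  (forall x, 0 < x -> c * (expR (- (k * x)) * v x) <= 1) -> c <= 1.
Proof.
move=> v1 H.
have e1 : expR (- (k * x)) @[x --> (0:R)^'+] --> (1 : R).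
  have : {for (0 : R), continuous (fun x : R => expR (- (k * x)))}.
    apply: continuous_comp; last exact: continuous_expR.
    apply: continuousN; apply: mulrl_continuous.
  by move/cvg_at_right_filter; rewrite mulr0 oppr0 expR0.
have cv : c * (expR (- (k * x)) * v x) @[x --> (0:R)^'+] --> c.
  by rewrite -[X in _ --> X]mulr1 -[X in _ * X]mulr1; apply: cvgMl_tmp; exact: cvgM.
apply: (cvgr_to_le cv).
near=> x; apply: H; near: x; exact: nbhs_right_gt.
Unshelve. all: by end_near. Qed.

Lemma cvg_ccdf_at_right0 (X : {RV P >-> R}) (f : R -> R) : is_pdf X f ->
  fine (ccdf X x) @[x --> (0:R)^'+] --> (1 : R).
Proof.
move=> hX.
have h0 : fine (cdf X x) @[x --> (0:R)^'+] --> (0 : R).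
  apply: fine_cvg; rewrite -[X in _ --> X%:E](is_pdf_cdf0 X f hX) fineK ?fin_num_measure//.
  exact: cdf_right_continuous.
rewrite (_ : (fun x => fine (ccdf X x)) = (fun x => 1 - fine (cdf X x))); last first.
  by apply/funext => x; rewrite -(fine_cdfD X x) addrC addKr.
rewrite -[X in _ --> X]subr0; apply: cvgB => //; exact: cvg_cst.
Qed.

End orders.

Section laplace_orders.
Context {R : realType}.
Context {d : measure_display} {Omega : measurableType d} {P : probability Omega R}.
Context {d' : measure_display} {Omega' : measurableType d'} {P' : probability Omega' R}.
Context {S : {RV P >-> R}} {T : {RV P' >-> R}} {f phi : R -> R} {c lam m : R}.
Let h x := c * (expR (lam * x) * phi x).
Hypothesis hphi : laplace_like m phi.
Hypothesis c0 : 0 < c.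
Hypothesis pdfT : is_pdf T f.
Hypothesis pdfS : is_pdf S (fun x => f x * h x).

Let convex_h : convexR h.
Proof.
move=> p x y p01; rewrite /h.
apply: (le_trans (ler_wpM2l (ltW c0) (laplace_like_convex hphi lam p x y p01))).
by rewrite mulrDr !(mulrCA c).
Qed.

Let h0 : h 0 = c.
Proof. by rewrite /h mulr0 expR0 (laplace_like0 hphi) !mulr1. Qed.

Let h_ge x : 0 < x -> c * expR (- (`|lam - m| * x)) <= h x.
Proof.
move=> x0; rewrite /h ler_pM2l//; apply: (le_trans _ (tilt_ge hphi lam x)).
rewrite ler_expR -mulNr; apply: ler_wpM2r; first exact: ltW.
by have := ler_norm (- (lam - m)); rewrite normrN lerNl.
Qed.

Lemma hr_le_laplace : hr_le T S <-> c <= 1.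
Proof.
split=> [/(hr_le_ratioP pdfT pdfS) H|c1]; last first.
  by apply: (hr_le_of_convex pdfT pdfS) => //; rewrite h0.
have c1 := cvg_ccdf_at_right0 T f pdfT.
apply: (le1_of_cvg_at_right0 c `|lam - m| _ c1) => x x0.
apply: le_trans (fine_ccdf_le1 S x); apply: le_trans (H x x0).
by rewrite mulrA ler_wpM2r ?h_ge// ltW// (is_pdf_ccdf_gt0 _ _ _ pdfT).
Qed.

(** Near 0 the distribution functions are in the ratio h 0 = c. *)
Lemma st_le_laplace : st_le T S <-> c <= 1.
Proof.
split=> [/(st_le_ratioP pdfT pdfS) H|c1]; last first.
  by apply: (st_le_of_convex pdfT pdfS) => //; rewrite h0.
apply: (le1_of_cvg_at_right0 _ `|lam - m| (cst 1)) => [|x x0]; first exact: cvg_cst.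
rewrite mulr1 -(ler_pM2r (is_pdf_cdf_gt0 _ _ _ pdfT x0)) mul1r.
apply: le_trans (H x x0); apply: (ratio_cdf_ge pdfT pdfS).
  by rewrite mulr_ge0 ?expR_ge0// ltW.
move=> y y0 yx; apply: (le_trans _ (h_ge y y0)).
by rewrite ler_pM2l// ler_expR lerN2 ler_wpM2l.
Qed.

Let h_nondecreasing : m <= lam -> forall x y, 0 < x -> x <= y -> h x <= h y.
Proof.
by move=> mlam x y x0 xy; rewrite /h ler_pM2l// (tilt_nondecreasing hphi)// ltW.
Qed.

Let h_decreasing : lam < m -> exists2 x, 0 < x & forall y, 0 < y -> y < x -> h x < h y.
Proof.
move=> lamm; have [x x0 H] := tilt_decreasing_near0 hphi lam lamm.
by exists x => // y y0 yx; rewrite /h ltr_pM2l// H.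
Qed.

Lemma lr_le_laplace : lr_le T S <-> m <= lam.
Proof.
split=> [/(lr_le_ratioP pdfT pdfS) H|mlam]; last first.
  by apply/(lr_le_ratioP pdfT pdfS); exact: h_nondecreasing.
rewrite leNgt; apply/negP => /h_decreasing[x x0 hx].
have x20 : 0 < x / 2 by lra.
have x2x : x / 2 < x by lra.
by have := H (x / 2) x x20 (ltW x2x); rewrite leNgt hx.
Qed.

Lemma rh_le_laplace : rh_le T S <-> m <= lam.
Proof.
split=> [/(rh_le_ratioP pdfT pdfS) H|mlam]; last first.
  apply/(rh_le_ratioP pdfT pdfS) => x x0; apply: (ratio_cdf_le pdfT pdfS).
    exact/ltW/(ratio_gt0 pdfT pdfS).
  by move=> y y0 yx; exact: h_nondecreasing.
rewrite leNgt; apply/negP => /h_decreasing[x x0 hx].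
by have := H x x0; rewrite leNgt (ratio_lt_cdf pdfT pdfS).
Qed.

End laplace_orders.

Section gamma_type_pdf.
Context {R : realType} {d : measure_display} {Omega : measurableType d}
  {P : probability Omega R}.

Lemma is_pdf_gamma_type (X : {RV P >-> R}) (K a : R) (phi : R -> R) : 0 < K ->
  measurable_fun setT phi -> (forall x, 0 < phi x) ->
  (forall x, 0 < x -> {for x, continuous phi}) ->
  has_density X (gamma_type K a phi) -> is_pdf X (gamma_type K a phi).
Proof.
move=> K0 mphi phi0 cphi hX; split => //.
- exact: measurable_gamma_type.
- exact: gamma_type_le0.
- by move=> x x0; rewrite /gamma_type x0 !mulr_gt0// powR_gt0.
move=> x; rewrite in_itv/= andbT => x0.
have E : \near x, K * x `^ (a - 1) * phi x = gamma_type K a phi x.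
  by near do rewrite /gamma_type ifT//; exact: lt_nbhsr.
have : K * y `^ (a - 1) * phi y @[y --> x] --> K * x `^ (a - 1) * phi x.
  apply: cvgM; last exact: cphi.
  apply: cvgMl_tmp.
  have /@ex_derive := @is_derive1_powR R (a - 1) x x0.
  by move=> /derivable1_diffP/differentiable_continuous.
have -> : K * x `^ (a - 1) * phi x = gamma_type K a phi x by rewrite /gamma_type x0.
move=> H; apply: cvg_trans H.
by apply: near_eq_cvg; apply: filterS E.
Unshelve. all: by end_near. Qed.

End gamma_type_pdf.

(** * Comparison with a gamma variable *)

Lemma powR_le_root {R : realType} (a x y : R) : 0 < a -> 0 < x -> 0 < y ->
  (x `^ a <= y) = (x <= y `^ a^-1).
Proof.
move=> a0 x0 y0; have aN0 : a != 0 by rewrite gt_eqF.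
have a0' : 0 <= a by exact: ltW.
have aV0 : 0 <= a^-1 by rewrite invr_ge0.
apply/idP/idP => H.
  rewrite -[x](powRr1 (ltW x0)) -(divff aN0) powRrM.
  by apply: (ge0_ler_powR aV0) => //; rewrite nnegrE ?powR_ge0// ltW.
rewrite -[y](powRr1 (ltW y0)) -(mulVf aN0) powRrM.
by apply: (ge0_ler_powR a0') => //; rewrite nnegrE ?powR_ge0// ltW.
Qed.

Theorem theorem3 (R : realType)
    (d : measure_display) (Omega : measurableType d) (P : probability Omega R)
    (d' : measure_display) (Omega' : measurableType d')
    (P' : probability Omega' R)
    (n : nat) (hn : (1 <= n)%N)
    (alpha beta_ : 'I_n -> R) (beta : R)
    (halpha : forall i, 0 < alpha i) (hbeta_ : forall i, 0 < beta_ i)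
    (hbeta : 0 < beta)
    (S_ : 'I_n -> {RV P >-> R})
    (hindep : independent_RVs S_)
    (hS_ : forall i, gamma_distributed (alpha i) 1 (S_ i))
    (S : {RV P >-> R})
    (hS : forall w, S w = \sum_(i < n) beta_ i * S_ i w)
    (T : {RV P' >-> R})
    (hT : gamma_distributed (\sum_(i < n) alpha i) beta T) :
  ((st_le T S <->
      beta <= (\prod_(i < n) beta_ i `^ alpha i) `^ (\sum_(i < n) alpha i)^-1)
   /\
   (hr_le T S <->
      beta <= (\prod_(i < n) beta_ i `^ alpha i) `^ (\sum_(i < n) alpha i)^-1))
  /\
  ((lr_le T S <->
      beta <= (\sum_(i < n) alpha i) / (\sum_(i < n) alpha i / beta_ i))
   /\
   (rh_le T S <->
      beta <= (\sum_(i < n) alpha i) / (\sum_(i < n) alpha i / beta_ i))).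
Proof.
set a := \sum_(i < n) alpha i.
set B := \prod_(i < n) beta_ i `^ alpha i.
set rho := \sum_(i < n) alpha i / beta_ i.
have [i0 [s Es]] : exists i0 s, index_enum 'I_n = i0 :: s.
  case E : (index_enum 'I_n) => [|i0 s]; last by exists i0, s.
  by have := mem_index_enum (Ordinal hn); rewrite E.
have us : uniq (i0 :: s) by rewrite -Es index_enum_uniq.
have [fa [phi hphi dphi]] := weighted_sum_density alpha beta_ S_ halpha hbeta_ hindep hS_ i0 s us.
have aE : shape alpha (i0 :: s) = a by rewrite -Es.
have BE : scales alpha beta_ (i0 :: s) = B by rewrite -Es.
have rE : rate alpha beta_ (i0 :: s) = rho / a by rewrite /rate aE -Es.
rewrite aE BE in fa dphi; rewrite rE in hphi.
have a0 : 0 < a by rewrite -aE; exact: shape_gt0.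
have B0 : 0 < B by rewrite -BE; exact: scales_gt0.
have rho0 : 0 < rho.
  rewrite /rho Es big_cons ltr_pwDl ?divr_gt0//.
  by apply: sumr_ge0 => i _; rewrite divr_ge0// ltW.
have G0 := gamma_fun_gt0 _ fa.
have dS : has_density S (gamma_type (gamma_fun a * B)^-1 a phi).
  move=> A mA.
  have := dphi finset.set0 (fun=> set0) _ _ A mA.
  have -> : joint_event S_ finset.set0 (fun=> set0) = setT.
    by apply/seteqP; split => // w _ k /=; rewrite inE.
  rewrite setIT probability_setT mul1e => <-; [|by move=> j; rewrite inE..].
  rewrite /distribution /pushforward; congr (P _).
  by apply/seteqP; split => w /=; rewrite /weighted_sum -Es hS.
have pT : is_pdf T (gamma_pdf a beta).
  rewrite gamma_pdfE; have he : laplace_like beta^-1 (fun x : R => expR (- (x * beta^-1))).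
    by apply: laplace_like_expR; rewrite invr_ge0 ltW.
  apply: is_pdf_gamma_type => //.
  - by rewrite mulr_gt0 ?powR_gt0// invr_gt0.
  - exact: measurable_laplace_like he.
  - by move=> x; exact: laplace_like_gt0 he x.
  - by move=> x x0; exact: laplace_like_continuous he x x0.
(* the ratio of the normalizing constants of the densities of S and T *)
pose c := beta `^ a / B.
have c0 : 0 < c by rewrite divr_gt0// powR_gt0.
have pS : is_pdf S (fun x => gamma_pdf a beta x * (c * (expR (beta^-1 * x) * phi x))).
  have -> : (fun x => gamma_pdf a beta x * (c * (expR (beta^-1 * x) * phi x))) =
      gamma_type (gamma_fun a * B)^-1 a phi.
    apply/funext => x; rewrite /gamma_pdf /gamma_type; case: ifPn => x0; last by rewrite mul0r.
    rewrite powRN expRN mulrC (mulrC beta^-1) /c.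
    have e0 : expR (x / beta) != 0 by rewrite gt_eqF// expR_gt0.
    have p0 : beta `^ a != 0 by rewrite gt_eqF// powR_gt0.
    by field; rewrite e0 p0 !gt_eqF.
  apply: is_pdf_gamma_type => //.
  - by rewrite invr_gt0 mulr_gt0.
  - exact: measurable_laplace_like hphi.
  - by move=> x; exact: laplace_like_gt0 hphi x.
  - by move=> x x0; exact: laplace_like_continuous hphi x x0.
have c1 : (c <= 1) = (beta <= B `^ a^-1).
  by rewrite /c ler_pdivrMr// mul1r powR_le_root.
have m1 : (rho / a <= beta^-1) = (beta <= a / rho).
  by rewrite -[rho / a]invf_div lef_pV2// posrE divr_gt0.
rewrite -c1 -m1; split; split.
- exact: (st_le_laplace hphi c0 pT pS).
- exact: (hr_le_laplace hphi c0 pT pS).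
- exact: (lr_le_laplace hphi c0 pT pS).
- exact: (rh_le_laplace hphi c0 pT pS).
Qed.
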